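(* Let $k\geq 1$ be a fixed integer. Then the following two statements hold: (1) There is a polynomial-time algorithm that, given a finite set $V$ and a $k$-hypergraph $\mathcal{H}$ on $V$, decides whether $\mathcal{H}$ is orderable. (2) There is a polynomial-time algorithm that, given an orderable $k$-hypergraph $\mathcal{H}$ on a finite set $V$, decides whether $\mathcal{H}$ has a perfect matching.
   Context: A $k$-hypergraph on a finite set $V$ is a set $\mathcal{H}$ of $k$-element subsets of $V$; elements of $V$ are vertices and elements of $\mathcal{H}$ are edges. A perfect matching in $\mathcal{H}$ is a subset $\{E_1,\dots,E_m\}\subseteq\mathcal{H}$ such that $V$ is the disjoint union of $E_1,\dots,E_m$. Let $n=|V|$. A $k$-hypergraph is orderable if there is an ordering $v_1,\dots,v_n$ of $V$ (an elimination order) such that each vertex $v_i$ is either dominating, meaning $E\in\mathcal{H}$ for every $k$-set $E$ with $v_i\in E\subseteq\{v_1,\dots,v_i\}$, or isolating, meaning $E\notin\mathcal{H}$ for every $k$-set $E$ with $v_i\in E\subseteq\{v_1,\dots,v_i\}$. Running time is measured in terms of $n$ (with $k$ fixed), the hypergraph being given by its list of edges. *)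

(* Defs.v *)
From mathcomp Require Import all_boot all_order.
Set Implicit Arguments. Unset Strict Implicit. Unset Printing Implicit Defensive.

Definition khypergraph (k n : nat) (H : {set {set 'I_n}}) : Prop :=
  forall E, E \in H -> #|E| = k.

(* prefix {v_1, ..., v_i} of an elimination order s (0-based index i) *)
Definition prefix_set n (s : n.-tuple 'I_n) (i : 'I_n) : {set 'I_n} :=
  [set tnth s j | j : 'I_n & j <= i].

Definition dominating k n (H : {set {set 'I_n}}) (s : n.-tuple 'I_n) (i : 'I_n)
  : Prop :=
  forall E : {set 'I_n}, #|E| = k -> tnth s i \in E ->
    E \subset prefix_set s i -> E \in H.

Definition isolating k n (H : {set {set 'I_n}}) (s : n.-tuple 'I_n) (i : 'I_n)
  : Prop :=
  forall E : {set 'I_n}, #|E| = k -> tnth s i \in E ->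
    E \subset prefix_set s i -> E \notin H.

Definition orderable k n (H : {set {set 'I_n}}) : Prop :=
  exists s : n.-tuple 'I_n, uniq s /\
    forall i : 'I_n, dominating k H s i \/ isolating k H s i.

Definition has_perfect_matching n (H : {set {set 'I_n}}) : Prop :=
  exists M : {set {set 'I_n}}, M \subset H /\ partition M [set: 'I_n].

(* Model of computation: deterministic one-tape Turing machines        *)
(* with finitely many states 'I_nq.+1 (start state ord0) and a finite  *)
(* tape alphabet 'I_ns.+4 (blank = ord0; input symbols 1,2,3).         *)
(* Moves: 0 = left, 1 = stay, 2 = right.  The machine halts when delta *)
(* is undefined; it accepts iff the halting state is accepting.        *)

Record TM := mkTM {
  tm_nq : nat;
  tm_ns : nat;
  tm_delta : {ffun 'I_tm_nq.+1 * 'I_tm_ns.+4 ->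
                   option ('I_tm_nq.+1 * 'I_tm_ns.+4 * 'I_3)};
  tm_acc : {ffun 'I_tm_nq.+1 -> bool}
}.

Definition sym (M : TM) := 'I_(tm_ns M).+4.
Definition state (M : TM) := 'I_(tm_nq M).+1.

(* configuration: state, left part (nearest cell first), scanned cell,
   right part (nearest cell first); cells beyond are blank *)
Definition config (M : TM) : Type :=
  (state M * seq (sym M) * sym M * seq (sym M))%type.

Definition blank (M : TM) : sym M := ord0.

Definition move_left M (l : seq (sym M)) (a : sym M) (r : seq (sym M)) :=
  match l with
  | [::] => ([::], blank M, a :: r)
  | b :: l' => (l', b, a :: r)
  end.

Definition move_right M (l : seq (sym M)) (a : sym M) (r : seq (sym M)) :=
  match r with
  | [::] => (a :: l, blank M, [::])
  | b :: r' => (a :: l, b, r')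
  end.

Definition step (M : TM) (c : config M) : config M :=
  let: (q, l, a, r) := c in
  match tm_delta M (q, a) with
  | None => c
  | Some (q', b, m) =>
      let: (l', a', r') :=
        if val m == 0 then move_left l b r
        else if val m == 1 then (l, b, r)
        else move_right l b r in
      (q', l', a', r')
  end.

Definition halted (M : TM) (c : config M) : bool :=
  let: (q, l, a, r) := c in tm_delta M (q, a) == None.

Definition accepting (M : TM) (c : config M) : bool :=
  let: (q, l, a, r) := c in tm_acc M q.

(* input: a word over the tokens 1, 2, 3 (as natural numbers) *)
Definition init (M : TM) (w : seq nat) : config M :=
  let w' := [seq (inord t : sym M) | t <- w] in
  (ord0, [::], head (blank M) w', behead w').

Definition run (M : TM) (w : seq nat) (t : nat) : config M :=
  iter t (step (M:=M)) (init M w).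

Definition decides_within (M : TM) (w : seq nat) (b : Prop) (t : nat) : Prop :=
  exists t', t' <= t /\ halted (run M w t') /\ (accepting (run M w t') <-> b).

(* Input encoding of (V, H), H given as its list of edges.            *)
(* Tokens: 1 = "one", 2 = "separator", 3 = "end".  Everything unary:  *)
(*   1^n 3  then for each edge E (vertices in increasing order v):    *)
(*   1^v 2 ... 1^v' 2 3                                               *)
(* Since k is fixed, the input length is polynomial in n and >= n,    *)
(* so polynomial in the input length = polynomial in n.               *)

Definition enc_edge n (E : {set 'I_n}) : seq nat :=
  flatten [seq rcons (nseq (val v) 1) 2 | v <- enum E] ++ [:: 3].

Definition enc_hypergraph n (es : seq {set 'I_n}) : seq nat :=
  rcons (nseq n 1) 3 ++ flatten [seq enc_edge E | E <- es].

Definition edge_list n (H : {set {set 'I_n}}) (es : seq {set 'I_n}) : Prop :=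
  uniq es /\ [set E in es] = H.

(* Main.v *)
(* Greedy elimination from the end of the order. A vertex v of W is dominating in W
   iff the number of edges E with v \in E \subset W is C(|W| - 1, k - 1), isolating iff
   this number is 0. Orderability passes to subsets, so H is orderable iff removing
   dominating or isolating vertices in any order empties V.
   For matchings, say that W has deficiency b if some matching inside W misses exactly
   b of its vertices. If v is isolating in W, then W has deficiency b iff b > 0 and
   W \ v has deficiency b - 1; if v is dominating and b + k <= |W|, iff W \ v has
   deficiency b + k - 1. Starting from (V, 0) and assuming k | n, after removing r
   vertices, of which l / k as dominating ones, b = l - r; hence a perfect matching
   exists iff k | n and r <= l holds throughout.
   The algorithm is a program with number registers, bit arrays and loops whose bound
   is the input length, so that it runs in polynomial time by construction. On the
   tape a register is a mark on the cell it points at, and each operation becomes one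
   sweep to the right followed by a return to the left end. *)
Require Import Defs.
From mathcomp Require Import all_boot all_order.
From mathcomp Require Import zify.
Set Implicit Arguments. Unset Strict Implicit. Unset Printing Implicit Defensive.

(** * A loop language *)

Record memory := Memory { reg : nat -> nat; arr : nat -> nat -> bool }.

Definition upd T (f : nat -> T) (r : nat) (x : T) : nat -> T :=
  fun r' => if r' == r then x else f r'.

Inductive op :=
  | Nop | Zero of nat | Inc of nat | Put of nat & nat & bool
  | Same of nat & nat | Less of nat & nat | Rd of nat & nat.

Definition exec_op (o : op) (m : memory) : memory :=
  match o with
  | Zero r => Memory (upd (reg m) r 0) (arr m)
  | Inc r => Memory (upd (reg m) r (reg m r).+1) (arr m)
  | Put b r v => Memory (reg m) (upd (arr m) b (upd (arr m b) (reg m r) v))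
  | _ => m
  end.

(** [N] is the length of the tape: a register with value at least [N] has no mark there, so no test
    involving it succeeds. *)
Definition test_op (N : nat) (o : op) (m : memory) : bool :=
  match o with
  | Same r s => (reg m r == reg m s) && (reg m r < N)
  | Less r s => (reg m r < reg m s) && (reg m s < N)
  | Rd b r => arr m b (reg m r) && (reg m r < N)
  | _ => false
  end.

Inductive cmd :=
  | Skip | Op of op | Seq of cmd & cmd | If of op & cmd & cmd | For of nat & cmd.

Fixpoint eval (N : nat) (c : cmd) (m : memory) : memory :=
  match c with
  | Skip => m
  | Op o => exec_op o m
  | Seq c1 c2 => eval N c2 (eval N c1 m)
  | If o c1 c2 =>
      if test_op N o m then eval N c1 (exec_op o m) else eval N c2 (exec_op o m)
  | For r c => iter N (fun m => exec_op (Inc r) (eval N c m)) (exec_op (Zero r) m)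
  end.

Definition op_writes (r : nat) (o : op) : bool :=
  match o with Zero s | Inc s => r == s | _ => false end.

Fixpoint writes (r : nat) (c : cmd) : bool :=
  match c with
  | Skip => false
  | Op o => op_writes r o
  | Seq c1 c2 => writes r c1 || writes r c2
  | If o c1 c2 => [|| op_writes r o, writes r c1 | writes r c2]
  | For s c => (r == s) || writes r c
  end.

Definition op_puts (b : nat) (o : op) : bool :=
  if o is Put b' _ _ then b == b' else false.

Fixpoint puts (b : nat) (c : cmd) : bool :=
  match c with
  | Skip => false
  | Op o => op_puts b o
  | Seq c1 c2 => puts b c1 || puts b c2
  | If o c1 c2 => [|| op_puts b o, puts b c1 | puts b c2]
  | For _ c => puts b c
  end.

(** A loop body must leave its counter alone: the flat code ends a loop by inspecting the counter,
    while [eval] iterates exactly [N] times. *)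
Fixpoint wf (c : cmd) : bool :=
  match c with
  | Seq c1 c2 | If _ c1 c2 => wf c1 && wf c2
  | For r c => ~~ writes r c && wf c
  | _ => true
  end.

Lemma exec_op_reg o r m : ~~ op_writes r o -> reg (exec_op o m) r = reg m r.
Proof. by case: o => //= s; rewrite /upd => /negbTE ->. Qed.

Lemma exec_op_arr o b m : ~~ op_puts b o -> arr (exec_op o m) b = arr m b.
Proof. by case: o => //= b' s v; rewrite /upd => /negbTE ->. Qed.

Lemma eval_reg N c r m : ~~ writes r c -> reg (eval N c m) r = reg m r.
Proof.
elim: c m => [|o|c1 IH1 c2 IH2|o c1 IH1 c2 IH2|s c IH] m //=.
- exact: exec_op_reg.
- by rewrite negb_or => /andP[h1 h2]; rewrite IH2 ?IH1.
- rewrite !negb_or => /and3P[h h1 h2].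
  by case: ifP => _; rewrite ?IH1 ?IH2 ?exec_op_reg.
- rewrite negb_or => /andP[h h1].
  move: {IH}(IH^~ h1); move: (eval N c) => f IH.
  by elim: N => [|k IHk] /=; rewrite /upd (negbTE h) // IH IHk.
Qed.

Lemma eval_arr N c b m : ~~ puts b c -> arr (eval N c m) b = arr m b.
Proof.
elim: c m => [|o|c1 IH1 c2 IH2|o c1 IH1 c2 IH2|s c IH] m //=.
- exact: exec_op_arr.
- by rewrite negb_or => /andP[h1 h2]; rewrite IH2 ?IH1.
- rewrite !negb_or => /and3P[h h1 h2].
  by case: ifP => _; rewrite ?IH1 ?IH2 ?exec_op_arr.
- move=> h1; move: {IH}(IH^~ h1); move: (eval N c) => f IH.
  by elim: N => [|k IHk] //=; rewrite IH IHk.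
Qed.

Lemma eval_ForP N r c (P : nat -> memory -> Prop) m :
    ~~ writes r c -> P 0 (exec_op (Zero r) m) ->
    (forall i m', i < N -> reg m' r = i -> P i m' ->
       P i.+1 (exec_op (Inc r) (eval N c m'))) ->
  P N (eval N (For r c) m).
Proof.
move=> nw P0 PS /=.
suff H i : i <= N -> reg (iter i (fun m => exec_op (Inc r) (eval N c m))
    (exec_op (Zero r) m)) r = i /\ P i (iter i (fun m => exec_op (Inc r)
      (eval N c m)) (exec_op (Zero r) m)) by case: (H N).
elim: i => [|i IH] lt_iN; first by rewrite /= /upd eqxx.
have [IH1 IH2] := IH (ltnW lt_iN); split; last exact: PS.
by rewrite iterS [LHS]/= /upd eqxx eval_reg // IH1.
Qed.

(** * Flat code *)

(** An operation with its jump targets for a successful and a failed test; an operation that is not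
    a test takes the second. *)
Definition instr := (op * nat * nat)%type.

Definition code_step (N : nat) (code : seq instr) (x : nat * memory) : nat * memory :=
  let: (pc, m) := x in
  if pc < size code then
    let: (o, t, f) := nth (Nop, 0, 0) code pc in
    (if test_op N o m then t else f, exec_op o m)
  else x.

Arguments code_step : simpl never.

Fixpoint len (c : cmd) : nat :=
  match c with
  | Skip => 0
  | Op _ => 1
  | Seq c1 c2 => len c1 + len c2
  | If _ c1 c2 => (len c1 + len c2).+2
  | For _ c => (len c).+3
  end.

(** Targets are absolute, hence the start address [pc]. [Nop] serves as the jump over the else
    branch, and [Same r r] as the loop guard, since it only tests [reg m r < N]. *)
Fixpoint comp (pc : nat) (c : cmd) : seq instr :=
  match c with
  | Skip => [::]
  | Op o => [:: (o, pc.+1, pc.+1)]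
  | Seq c1 c2 => comp pc c1 ++ comp (pc + len c1) c2
  | If o c1 c2 =>
      let pe := pc + (len c1 + len c2).+2 in
      (o, pc.+1, pc + (len c1).+2) ::
        comp pc.+1 c1 ++ (Nop, pe, pe) :: comp (pc + (len c1).+2) c2
  | For r c =>
      [:: (Zero r, pc.+1, pc.+1), (Same r r, pc.+2, pc + (len c).+3) &
        rcons (comp pc.+2 c) (Inc r, pc.+1, pc.+1)]
  end.

Fixpoint cost (N : nat) (c : cmd) : nat :=
  match c with
  | Skip => 0
  | Op _ => 1
  | Seq c1 c2 => cost N c1 + cost N c2
  | If _ c1 c2 => (cost N c1 + cost N c2).+2
  | For _ c => (N * (cost N c).+2).+2
  end.

Lemma size_comp pc c : size (comp pc c) = len c.
Proof.
elim: c pc => [|o|c1 IH1 c2 IH2|o c1 IH1 c2 IH2|s c IH] pc //=.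
- by rewrite size_cat IH1 IH2.
- by rewrite size_cat /= IH1 IH2 addnS.
- by rewrite size_rcons IH.
Qed.

Lemma comp_targets pc c :
  all (fun i : instr => (i.1.2 <= pc + len c) && (i.2 <= pc + len c)) (comp pc c).
Proof.
have mono (a b : nat) s : a <= b ->
    all (fun i : instr => (i.1.2 <= a) && (i.2 <= a)) s ->
    all (fun i : instr => (i.1.2 <= b) && (i.2 <= b)) s.
  by move=> le_ab; apply: sub_all => i /andP[h1 h2]; rewrite !(leq_trans _ le_ab).
elim: c pc => [|o|c1 IH1 c2 IH2|o c1 IH1 c2 IH2|s c IH] pc //=.
- by rewrite addn1 leqnn.
- rewrite all_cat; apply/andP; split;
    [apply: (mono _ _ _ _ (IH1 _)) | apply: (mono _ _ _ _ (IH2 _))]; lia.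
- rewrite all_cat /=; apply/and3P; split; first lia.
    by apply: (mono _ _ _ _ (IH1 _)); lia.
  by apply/andP; split; [lia | apply: (mono _ _ _ _ (IH2 _)); lia].
- rewrite all_rcons /=; apply/and3P; split; [lia | lia |].
  by apply/andP; split; [lia | apply: (mono _ _ _ _ (IH _)); lia].
Qed.

Lemma code_step_at N pre post o t f m :
  code_step N (pre ++ (o, t, f) :: post) (size pre, m) =
  (if test_op N o m then t else f, exec_op o m).
Proof. by rewrite /code_step size_cat /= addnS ltnS leq_addr nth_cat ltnn subnn. Qed.

(** As addresses are absolute, the induction places the code between arbitrary [pre] and [post];
    each case re-brackets the code so that the part being run stands in the middle. *)
Lemma compP N c : wf c -> forall pre post m, exists t, t <= cost N c /\
  iter t (code_step N (pre ++ comp (size pre) c ++ post)) (size pre, m) =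
  (size pre + len c, eval N c m).
Proof.
elim: c => [|o|c1 IH1 c2 IH2|o c1 IH1 c2 IH2|r c IH] /=.
- by move=> _ pre post m; exists 0; rewrite addn0.
- move=> _ pre post m; exists 1; split=> //=.
  by rewrite code_step_at addn1; case: ifP.
- case/andP=> /IH1{}IH1 /IH2{}IH2 pre post m.
  have [t1 [le1 e1]] := IH1 pre (comp (size pre + len c1) c2 ++ post) m.
  have [t2 [le2 e2]] := IH2 (pre ++ comp (size pre) c1) post (eval N c1 m).
  exists (t2 + t1); split; first lia.
  rewrite -catA iterD e1; move: e2.
  by rewrite size_cat size_comp -!catA addnA => ->.
- case/andP=> /IH1{}IH1 /IH2{}IH2 pre post m.
  set pe := size pre + (len c1 + len c2).+2; set code := pre ++ _.
  set m' := exec_op o m.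
  have s0 : code_step N code (size pre, m) =
      (if test_op N o m then (size pre).+1 else size pre + (len c1).+2, m').
    by rewrite /code /= code_step_at.
  case E: (test_op N o m) s0 => s0.
    have [t1 [le1 e1]] := IH1 (rcons pre (o, (size pre).+1, size pre + (len c1).+2))
      ((Nop, pe, pe) :: comp (size pre + (len c1).+2) c2 ++ post) m'.
    exists (t1.+1).+1; split; first lia.
    rewrite iterS iterSr s0; move: e1; rewrite size_rcons cat_rcons.
    have -> : pre ++ (o, (size pre).+1, size pre + (len c1).+2) :: comp (size pre).+1 c1
      ++ (Nop, pe, pe) :: comp (size pre + (len c1).+2) c2 ++ post = code.
      by rewrite /code /= -!catA.
    move=> ->.
    have -> : code = (pre ++ (o, (size pre).+1, size pre + (len c1).+2) ::
        comp (size pre).+1 c1) ++ (Nop, pe, pe) ::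
        (comp (size pre + (len c1).+2) c2 ++ post).
      by rewrite /code /= -!catA.
    have -> : (size pre).+1 + len c1 = size (pre ++ (o, (size pre).+1,
        size pre + (len c1).+2) :: comp (size pre).+1 c1).
      by rewrite size_cat /= size_comp addnS.
    by rewrite code_step_at.
  have [t2 [le2 e2]] := IH2 (pre ++ (o, (size pre).+1, size pre + (len c1).+2) ::
      rcons (comp (size pre).+1 c1) (Nop, pe, pe)) post m'.
  exists t2.+1; split; first lia.
  rewrite iterSr s0; move: e2; rewrite size_cat /= size_rcons size_comp -/m'.
  rewrite -!catA /= cat_rcons.
  have -> : code = pre ++ (o, (size pre).+1, size pre + (len c1).+2) ::
      (comp (size pre).+1 c1 ++ (Nop, pe, pe) ::
        comp (size pre + (len c1).+2) c2 ++ post).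
    by rewrite /code /= -!catA.
  by move=> ->; congr pair; rewrite /pe; lia.
- case/andP=> nw /IH{}IH pre post m.
  set code := pre ++ _.
  pose body m' := exec_op (Inc r) (eval N c m').
  rewrite -/body.
  set i1 := (Zero r, (size pre).+1, (size pre).+1).
  set i2 := (Same r r, (size pre).+2, size pre + (len c).+3).
  set i3 := (Inc r, (size pre).+1, (size pre).+1).
  have code1 : code = pre ++ i1 :: i2 :: comp (size pre).+2 c ++ i3 :: post.
    by rewrite /code /= cat_rcons.
  have code2 : code = rcons pre i1 ++ i2 :: (comp (size pre).+2 c ++ i3 :: post).
    by rewrite code1 cat_rcons.
  have code3 : code = rcons (rcons pre i1) i2 ++
      comp (size (rcons (rcons pre i1) i2)) c ++ i3 :: post.
    by rewrite code2 !cat_rcons !size_rcons.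
  have code4 : code = (pre ++ i1 :: i2 :: comp (size pre).+2 c) ++ i3 :: post.
    by rewrite code1 /= -!catA.
  have s1 m' : code_step N code (size pre, m') = ((size pre).+1, exec_op (Zero r) m').
    by rewrite code1 code_step_at.
  have s2 m' : code_step N code ((size pre).+1, m') =
      (if reg m' r < N then (size pre).+2 else size pre + (len c).+3, m').
    by have := code_step_at N (rcons pre i1); rewrite code2 size_rcons => ->; rewrite /= eqxx.
  have s3 m' : code_step N code ((size pre).+2 + len c, m') =
      ((size pre).+1, exec_op (Inc r) m').
    have -> : (size pre).+2 + len c = size (pre ++ i1 :: i2 :: comp (size pre).+2 c).
      by rewrite size_cat /= size_comp; lia.
    by rewrite code4 code_step_at.
  (* Induction on the number [j] of rounds left; the guard at [i = N] leaves the loop. *)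
  have loop j i m' : i + j = N -> reg m' r = i ->
      exists t, t <= (j * (cost N c).+2).+1 /\
        iter t (code_step N code) ((size pre).+1, m') =
        (size pre + (len c).+3, iter j body m').
    elim: j i m' => [|j IHj] i m' eN Em'.
      by exists 1; split; rewrite //= s2 Em' ifF //; lia.
    have [t1 [le1 e1]] := IH (rcons (rcons pre i1) i2) (i3 :: post) m'.
    rewrite -code3 !size_rcons in e1.
    have Eb : reg (body m') r = i.+1 by rewrite /body /= /upd eqxx eval_reg // Em'.
    have [|t2 [le2 e2]] := IHj i.+1 (body m') _ Eb; first lia.
    exists (t2 + t1.+2); split; first lia.
    rewrite iterD iterS iterSr s2 Em' ifT; last lia.
    by rewrite e1 s3 e2 -iterSr.
  have [||t [le e]] := loop N 0 (exec_op (Zero r) m) => //.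
    by rewrite /= /upd eqxx.
  by exists t.+1; split=> //; rewrite iterSr s1.
Qed.

(** * Polynomial bound on the number of instructions *)

Fixpoint cost_deg (c : cmd) : nat :=
  match c with
  | Skip | Op _ => 0
  | Seq c1 c2 | If _ c1 c2 => cost_deg c1 + cost_deg c2
  | For _ c => (cost_deg c).+1
  end.

Fixpoint cost_coef (c : cmd) : nat :=
  match c with
  | Skip => 0
  | Op _ => 1
  | Seq c1 c2 => cost_coef c1 + cost_coef c2
  | If _ c1 c2 => (cost_coef c1 + cost_coef c2).+2
  | For _ c => cost_coef c + 4
  end.

(** Degrees of consecutive pieces are added rather than maximised; as [0 < N], both bounds can be
    raised to the common exponent. *)
Lemma cost_poly N c : 0 < N -> cost N c <= cost_coef c * N ^ cost_deg c.
Proof.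
move=> N0; have pos d : 0 < N ^ d by rewrite expn_gt0 N0.
have mono d e (x y : nat) : x <= y * N ^ d -> x <= y * N ^ (d + e).
  by move/leq_trans; apply; rewrite leq_mul2l leq_pexp2l ?leq_addr ?orbT.
have two d e c1 c2 x y : x <= c1 * N ^ d -> y <= c2 * N ^ e ->
    x + y <= (c1 + c2) * N ^ (d + e).
  move=> /(mono _ e) h1 /(mono _ d) h2.
  by rewrite mulnDl leq_add // addnC.
elim: c => [|o|c1 IH1 c2 IH2|o c1 IH1 c2 IH2|s c IH] //=.
- exact: two.
- have := two _ _ _ _ _ _ IH1 IH2; have := pos (cost_deg c1 + cost_deg c2).
  by rewrite -addn2 mulnDl; lia.
- rewrite expnS; have := pos (cost_deg c); move: (N ^ _) IH => x IH px.
  have : N * (cost N c).+2 <= N * (cost_coef c * x + 2) by rewrite leq_mul2l; lia.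
  have : 0 < N * x by rewrite muln_gt0 N0.
  have : N <= N * x by rewrite leq_pmulr.
  move: (cost N c) (cost_coef c) IH => u v; nia.
Qed.

(** * Operations as left-to-right sweeps *)

(* A cell records which registers point at it and the array bits stored there. *)
Definition cell (K : nat) : finType :=
  ({ffun 'I_K.+1 -> bool} * {ffun 'I_K.+1 -> bool})%type.

Definition mark K (c : cell K) (r : nat) : bool := c.1 (inord r).
Definition bit K (c : cell K) (b : nat) : bool := c.2 (inord b).
Definition set_mark K (c : cell K) (r : nat) (v : bool) : cell K :=
  ([ffun i => if i == inord r then v else c.1 i], c.2).
Definition set_bit K (c : cell K) (b : nat) (v : bool) : cell K :=
  (c.1, [ffun i => if i == inord b then v else c.2 i]).

Definition cell_at K (m : memory) (i : nat) : cell K :=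
  ([ffun r => reg m (val r) == i], [ffun b => arr m (val b) i]).

Definition tape_of K (N : nat) (m : memory) : seq (cell K) := mkseq (cell_at K m) N.

Definition sweep_state : finType := (bool * bool)%type.

(* [Inc r] shifts the mark of [r] by one cell, the mark being carried in the
   state; in the other cases the first component is the outcome of the test. *)
Definition sweep K (o : op) (s : sweep_state) (c : cell K) : sweep_state * cell K :=
  match o with
  | Nop => (s, c)
  | Zero r => ((true, false), set_mark c r (~~ s.1))
  | Inc r => ((mark c r, false), set_mark c r s.1)
  | Put b r v => (s, if mark c r then set_bit c b v else c)
  | Same r r' => ((s.1 || (mark c r && mark c r'), false), c)
  | Less r r' => ((s.1 || (s.2 && mark c r'), s.2 || mark c r), c)
  | Rd b r => ((s.1 || (bit c b && mark c r), false), c)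
  end.

Definition sweep_out (o : op) (s : sweep_state) : bool :=
  match o with Same _ _ | Less _ _ | Rd _ _ => s.1 | _ => false end.

Fixpoint sweeps K (o : op) (s : sweep_state) (w : seq (cell K))
    : sweep_state * seq (cell K) :=
  if w is c :: w' then
    let: (s1, c1) := sweep o s c in
    let: (s2, w2) := sweeps o s1 w' in (s2, c1 :: w2)
  else (s, [::]).

Definition op_index (o : op) : nat :=
  match o with
  | Nop => 0
  | Zero r | Inc r => r
  | Put b r _ | Rd b r => maxn b r
  | Same r s | Less r s => maxn r s
  end.

Lemma sweeps_iota K o (st : nat -> sweep_state) (f g : nat -> cell K) a n :
    (forall i, sweep o (st i) (f i) = (st i.+1, g i)) ->
  sweeps o (st a) (map f (iota a n)) = (st (a + n), map g (iota a n)).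
Proof.
move=> H; elim: n a => [|n IH] a /=; first by rewrite addn0.
by rewrite H IH addSnnS.
Qed.

Lemma mark_at K m i r : r <= K -> mark (cell_at K m i) r = (reg m r == i).
Proof. by move=> le_r; rewrite /mark ffunE /= inordK. Qed.

Lemma bit_at K m i b : b <= K -> bit (cell_at K m i) b = arr m b i.
Proof. by move=> le_b; rewrite /bit ffunE /= inordK. Qed.

Lemma eq_inord K (i : 'I_K.+1) r : r <= K -> (i == inord r) = (val i == r).
Proof. by move=> le_r; rewrite -val_eqE /= inordK. Qed.

(** For each operation, a closed form of the state before cell [i] reduces the sweep to a check of a
    single cell. The bound on [op_index] makes [inord] faithful on the indices used. *)
Lemma sweepsP K N o m : op_index o <= K ->
  exists s, sweeps o (false, false) (tape_of K N m) = (s, tape_of K N (exec_op o m))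
    /\ sweep_out o s = test_op N o m.
Proof.
move=> leK.
suff [st [st0 stS stN]] : exists st : nat -> sweep_state,
    [/\ st 0 = (false, false),
        forall i, sweep o (st i) (cell_at K m i) =
          (st i.+1, cell_at K (exec_op o m) i)
      & sweep_out o (st N) = test_op N o m].
  exists (st N); split=> //; rewrite /tape_of /mkseq -st0.
  exact: (sweeps_iota 0 N stS).
case: o leK => [|r|r|b r v|r r'|r r'|b r] /= leK.
- by exists (fun=> (false, false)).
- exists (fun i => (0 < i, false)); split=> // i; congr (_, (_, _)).
  apply/ffunP=> j; rewrite !ffunE eq_inord // /upd /=.
  by case: eqP => // _; case: i.
(* The carry before cell [i] is the old mark of cell [i.-1]; a mark in the last cell drops off the
   tape, in accordance with the new value [N]. *)
- exists (fun i => ((0 < i) && (reg m r == i.-1), false)); split=> // i.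
  rewrite mark_at //=; congr (_, (_, _)).
  apply/ffunP=> j; rewrite !ffunE eq_inord // /upd /=.
  by case: eqP => // _; case: i.
- move: leK; rewrite geq_max => /andP[leb ler].
  exists (fun=> (false, false)); split=> // i; congr (_, _).
  rewrite mark_at //; case: eqP => E; congr (_, _);
    apply/ffunP=> j; rewrite !ffunE ?eq_inord // /upd /=; case: eqP => // Ej.
    by rewrite E eqxx.
  by rewrite Ej; case: eqP => // Ei; case: E.
- move: leK; rewrite geq_max => /andP[le1 le2].
  exists (fun i => ((reg m r == reg m r') && (reg m r < i), false)); split=> //.
    by rewrite andbF.
  move=> i; rewrite !mark_at //=; congr ((_, _), _); lia.
- move: leK; rewrite geq_max => /andP[le1 le2].
  (* The second component says that the mark of [r] lies strictly to the left, so that a mark of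
     [r'] counts only when met later. *)
  exists (fun i => ((reg m r < reg m r') && (reg m r' < i), reg m r < i)); split=> //.
    by rewrite andbF.
  move=> i; rewrite !mark_at //=; congr ((_, _), _); lia.
- move: leK; rewrite geq_max => /andP[le1 le2].
  exists (fun i => (arr m b (reg m r) && (reg m r < i), false)); split=> //.
    by rewrite andbF.
  move=> i; rewrite bit_at // mark_at //=; congr ((_, _), _).
  rewrite ltnS [in RHS]leq_eqVlt andb_orr orbC; congr (_ || _).
  by case: eqP => [->|_]; rewrite ?andbF.
Qed.

(** * The Turing machine of a flat code *)

(** [P] will be the code length plus two: the extra addresses are the accepting and the rejecting
    halt. *)
Definition ctrl (P : nat) : finType := (('I_P * sweep_state) + 'I_P)%type.

(* [inl (pc, s)]: sweeping to the right for the instruction [pc];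
   [inr pc]: returning to the left end before the instruction [pc]. *)
Definition ctrl_delta (code : seq instr) K
    (q : ctrl (size code).+2) (a : option (cell K))
    : option (ctrl (size code).+2 * option (cell K) * 'I_3) :=
  match q with
  | inl (pc, s) =>
      if pc < size code then
        let: (o, t, f) := nth (Nop, 0, 0) code pc in
        match a with
        | Some c => let: (s', c') := sweep o s c in
                    Some (inl (pc, s'), Some c', inord 2)
        | None => Some (inr (inord (if sweep_out o s then t else f)), None, inord 0)
        end
      else None
  | inr pc =>
      match a with
      | Some c => Some (inr pc, Some c, inord 0)
      | None => Some (inl (pc, (false, false)), None, inord 2)
      end
  end.

(** A token is read as an unmarked cell with one array bit set, so the input word already is the
    tape of the initial memory. *)
Definition token_cell K (t : nat) : cell K :=
  ([ffun=> false], [ffun b => (0 < val b) && (val b == t)]).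

(** Decoding is not injective: a token and the code of its [token_cell] stand for the same cell.
    Hence the machine is compared with its abstract version only after decoding. *)
Definition dec_sym K (a : 'I_#|cell K|.+4) : option (cell K) :=
  match @split 4 #|cell K| a with
  | inl t => if val t == 0 then None else Some (token_cell K t)
  | inr j => Some (enum_val j)
  end.

Definition enc_sym K (a : option (cell K)) : 'I_#|cell K|.+4 :=
  if a is Some c then rshift 4 (enum_rank c) else ord0.

Definition dec_ctrl P (q : 'I_#|ctrl P.+1|.+1) : ctrl P.+1 :=
  if unlift ord0 q is Some i then enum_val i else inl (ord0, (false, false)).

Definition enc_ctrl P (q : ctrl P.+1) : 'I_#|ctrl P.+1|.+1 :=
  lift ord0 (enum_rank q).

Lemma enc_symK K : cancel (@enc_sym K) (@dec_sym K).
Proof.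
case=> [c|] /=; rewrite /dec_sym; last first.
  by case: split_ordP => [t /(congr1 val) /= <-|t /(congr1 val)].
by have := unsplitK (inr (enum_rank c) : 'I_4 + 'I__)%type => /= ->; rewrite enum_rankK.
Qed.

Lemma enc_ctrlK P : cancel (@enc_ctrl P) (@dec_ctrl P).
Proof. by move=> q; rewrite /dec_ctrl /enc_ctrl liftK enum_rankK. Qed.

Lemma dec_blank K : dec_sym (ord0 : 'I_#|cell K|.+4) = None.
Proof. exact: (enc_symK None). Qed.

Lemma dec_token K t : 0 < t < 4 ->
  dec_sym (inord t : 'I_#|cell K|.+4) = Some (token_cell K t).
Proof.
case/andP=> t0 t4; rewrite /dec_sym.
case: split_ordP => [j /(congr1 val)|j /(congr1 val)] /=; rewrite inordK; try lia.
by move=> <-; rewrite eqn0Ngt t0.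
Qed.

Definition code_machine (code : seq instr) (K : nat) : TM :=
  @mkTM #|ctrl (size code).+2| #|cell K|
    [ffun x => if ctrl_delta (dec_ctrl x.1) (dec_sym x.2) is Some (q, a, d)
               then Some (enc_ctrl q, enc_sym a, d) else None]
    [ffun q => if dec_ctrl q is inl (pc, _) then val pc == size code else false].

Definition dcfg (code : seq instr) (K : nat) : Type :=
  (ctrl (size code).+2 * seq (option (cell K)) * option (cell K)
    * seq (option (cell K)))%type.

Definition dec_cfg code K (c : config (code_machine code K)) : dcfg code K :=
  let: (q, l, a, r) := c in
  (dec_ctrl q, map (@dec_sym K) l, dec_sym a, map (@dec_sym K) r).

Definition dstep code K (c : dcfg code K) : dcfg code K :=
  let: (q, l, a, r) := c in
  match ctrl_delta q a with
  | None => c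
  | Some (q', b, d) =>
      if val d == 0 then (q', behead l, head None l, b :: r)
      else if val d == 1 then (q', l, b, r)
      else (q', b :: l, head None r, behead r)
  end.

Lemma dec_step code K (c : config (code_machine code K)) :
  dec_cfg (step c) = dstep (dec_cfg c).
Proof.
case: c => [[[q l] a] r] /=; rewrite ffunE /=.
case: (ctrl_delta _ _) => [[[q' b] d]|] //=.
case: eqP => _.
  by case: l => [|x l] /=; rewrite ?enc_ctrlK ?enc_symK ?dec_blank.
case: eqP => _ /=; first by rewrite enc_ctrlK enc_symK.
by case: r => [|x r] /=; rewrite ?enc_ctrlK ?enc_symK ?dec_blank.
Qed.

Lemma dec_iter_step code K t (c : config (code_machine code K)) :
  dec_cfg (iter t (@step _) c) = iter t (@dstep code K) (dec_cfg c).
Proof. by elim: t => //= t <-; rewrite dec_step. Qed.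

(* Moving the head past the ends of the word materialises blanks, whence the
   unspecified numbers of blanks on both sides. *)
Definition at_start code K (pc : nat) (w : seq (cell K)) (c : dcfg code K) : Prop :=
  exists i j, let x := map some w ++ nseq j None in
  c = (inl (inord pc, (false, false)), nseq i None, head None x, behead x).

(** The cells passed pile up in reverse order on the left; [j.-1] because the head ends on the first
    blank after the word, one of the [j] if there are any. *)
Lemma dstep_right code K (pc : 'I_(size code).+2) o t f s l (w : seq (cell K)) j :
    pc < size code -> nth (Nop, 0, 0) code pc = (o, t, f) ->
  let x := map some w ++ nseq j None in
  let: (s', w') := sweeps o s w in
  iter (size w) (@dstep code K) (inl (pc, s), l, head None x, behead x) =
  (inl (pc, s'), map some (rev w') ++ l, None, nseq j.-1 None).
Proof.
move=> lt_pc Epc /=; elim: w s l => [|c w IH] s l /=; first by case: j.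
case E: (sweep o s c) => [s1 c1].
move: (IH s1 (Some c1 :: l)); case: (sweeps o s1 w) => s2 w2.
rewrite -iterS iterSr /= lt_pc Epc E inordK //= => ->.
by rewrite rev_cons map_rcons cat_rcons.
Qed.

(** [size u] moves reach the blank before the word, and one more re-enters the word. *)
Lemma dstep_left code K (pc : 'I_(size code).+2) (u : seq (cell K)) i r :
  let x := map some u ++ nseq i None in
  iter (size u).+1 (@dstep code K) (inr pc, behead x, head None x, r) =
  (inl (pc, (false, false)), None :: nseq i.-1 None,
    head None (map some (rev u) ++ r), behead (map some (rev u) ++ r)).
Proof.
elim: u r => [|c u IH] r; first by case: i => [|i] /=; rewrite inordK.
move=> x; rewrite [size _]/= iterSr {}/x /= inordK //= -iterS IH /=.
by rewrite rev_cons map_rcons cat_rcons.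
Qed.

Lemma at_start_step code K N pc m c :
    all (fun i : instr => [&& i.1.2 < (size code).+2, i.2 < (size code).+2
                            & op_index i.1.1 <= K]) code ->
    pc < size code -> at_start pc (tape_of K N m) c ->
  let x := code_step N code (pc, m) in
  at_start x.1 (tape_of K N x.2) (iter (N + N).+2 (@dstep code K) c).
Proof.
move=> /(all_nthP (Nop, 0, 0)) ok lt_pc [i [j Ec]].
(* [N] moves to the right and a turn at the blank, then [N.+1] moves for the return. *)
have -> : (N + N).+2 = N.+1 + N.+1 by rewrite addnS.
rewrite /= /code_step lt_pc.
case Epc: (nth _ code pc) (ok _ lt_pc) => [[o t] f] /= /and3P[lt_t lt_f leK].
have [s [Es <-]] := sweepsP N m leK.
have vpc : val (inord pc : 'I_(size code).+2) = pc by rewrite /= inordK //; lia.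
have sz m' : size (tape_of K N m') = N by rewrite size_mkseq.
have := @dstep_right code K (inord pc) o t f (false, false) (nseq i None)
  (tape_of K N m) j; rewrite vpc => /(_ lt_pc Epc) /=; rewrite Es sz => E1.
set pc' := if _ then _ else _; set w' := tape_of K N (exec_op o m).
have E2 : dstep (inl (inord pc, s), map some (rev w') ++ nseq i None, None,
      nseq j.-1 None) =
    ((inr (inord pc'), behead (map some (rev w') ++ nseq i None),
      head None (map some (rev w') ++ nseq i None), None :: nseq j.-1 None)
     : dcfg code K).
  by rewrite /= vpc lt_pc Epc inordK.
have := dstep_left (inord pc' : 'I_(size code).+2) (rev w') i (None :: nseq j.-1 None).
rewrite size_rev sz revK /= => E3.
exists i.-1.+1, j.-1.+1.
by rewrite Ec iterD iterS E1 E2 E3.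
Qed.

Lemma at_start_iter code K N t pc m c :
    all (fun i : instr => [&& i.1.2 < (size code).+2, i.2 < (size code).+2
                            & op_index i.1.1 <= K]) code ->
    at_start pc (tape_of K N m) c ->
  let x := iter t (code_step N code) (pc, m) in
  exists u, u <= t * (N + N).+2 /\
    at_start x.1 (tape_of K N x.2) (iter u (@dstep code K) c).
Proof.
move=> ok c0; elim: t => [|t [u [le_u IH]]] /=; first by exists 0.
case E: (iter t _ _) IH => [pc' m'] /= IH.
have [lt_pc|ge_pc] := ltnP pc' (size code).
  exists ((N + N).+2 + u); split; first by rewrite mulSn leq_add2l.
  by rewrite iterD; apply: (at_start_step ok).
exists u; split; first by rewrite mulSn; lia.
by rewrite /code_step ltnNge ge_pc.
Qed.

(* Registers start out of range, i.e. without a mark on the tape. *)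
Definition init_memory (w : seq nat) : memory :=
  Memory (fun=> size w) (fun b i => (0 < b) && (b == nth 0 w i)).

Lemma init_at_start code K w : all (fun t => 0 < t < 4) w ->
  at_start 0 (tape_of K (size w) (init_memory w)) (dec_cfg (init (code_machine code K) w)).
Proof.
move=> ok; exists 0, 0; rewrite cats0 /=.
have -> : map some (tape_of K (size w) (init_memory w)) =
    map (@dec_sym K) (map inord w).
  apply: (@eq_from_nth _ None); first by rewrite !size_map size_iota.
  rewrite !size_map size_iota => i lt_i.
  rewrite (nth_map (token_cell K 0)) ?size_mkseq // nth_mkseq //.
  rewrite -map_comp (nth_map 0) //= dec_token ?(all_nthP 0 ok) //.
  congr (Some (_, _)); apply/ffunP => b; rewrite !ffunE //=.
  by rewrite gtn_eqF.
have -> : dec_ctrl (ord0 : 'I_#|ctrl (size code).+2|.+1) = inl (inord 0, (false, false)).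
  by rewrite /dec_ctrl unlift_none; congr (inl (_, _)); apply/val_inj; rewrite /= inordK.
by case: (map inord w) => [|a l] /=; rewrite ?dec_blank.
Qed.

Theorem cmd_decides (p : cmd) (o : op) : wf p ->
  exists (M : TM) (c d : nat), forall w, all (fun t => 0 < t < 4) w -> 0 < size w ->
    decides_within M w (test_op (size w) o (eval (size w) p (init_memory w)))
      (c * size w ^ d + c).
Proof.
move=> wfp; set L := len p.
(* The final test jumps to [size code], which accepts, or to the next address, which rejects; both
   lie past the code, so the machine halts. *)
pose code := comp 0 p ++ [:: (o, L.+1, L.+2)].
pose K := \max_(j <- [seq op_index i.1.1 | i <- code]) j.
have szc : size code = L.+1 by rewrite size_cat size_comp addn1.
have ok : all (fun i : instr => [&& i.1.2 < (size code).+2, i.2 < (size code).+2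
                            & op_index i.1.1 <= K]) code.
  apply/(all_nthP (Nop, 0, 0)) => i lt_i; rewrite andbA.
  apply/andP; split; last first.
    rewrite /K; apply: (@leq_bigmax_seq _ _ xpredT id) => //.
    by rewrite -(nth_map _ 0 (fun i : instr => op_index i.1.1)) // mem_nth ?size_map.
  rewrite szc /code nth_cat size_comp; case: ifP => [lt_iL|ge_iL].
    have /(all_nthP (Nop, 0, 0))/(_ i) := comp_targets 0 p.
    by rewrite size_comp -/L => /(_ lt_iL); lia.
  by rewrite (_ : i - len p = 0) /=; move: lt_i; rewrite szc -/L; lia.
(* At most [(cost_coef p).+1 * N ^ cost_deg p] instructions are executed, the final test included,
   each in [2 * N + 2 <= 4 * N] machine steps. *)
exists (code_machine code K), (4 * (cost_coef p).+1), (cost_deg p).+1 => w wok w0.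
set N := size w.
have [t [le_t Et]] := compP N wfp [::] [:: (o, L.+1, L.+2)] (init_memory w).
have := at_start_iter t.+1 ok (init_at_start code K wok).
rewrite -/N iterS; rewrite /= add0n -/L -/code in Et; rewrite Et.
have -> : code_step N code (L, eval N p (init_memory w)) =
    (if test_op N o (eval N p (init_memory w)) then L.+1 else L.+2,
     exec_op o (eval N p (init_memory w))).
  by have := code_step_at N (comp 0 p) [::] o L.+1 L.+2; rewrite size_comp; apply.
set b := test_op _ _ _.
case=> u [le_u]; rewrite -dec_iter_step => -[i [j Eu]].
exists u; split.
  apply: leq_trans le_u _; have := cost_poly p w0; rewrite expnS -/N.
  have : 0 < N ^ cost_deg p by rewrite expn_gt0 w0.
  move: (N ^ _) (cost_coef p) le_t w0 => x k; move: (cost N p); rewrite -/N.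
  move=> C le_t N0 x0 leC.
  have h1 : t.+1 <= k.+1 * x by nia.
  have h2 : (N + N).+2 <= 4 * N by lia.
  apply: leq_trans (leq_mul h1 h2) _.
  by rewrite (_ : _ * _ * _ = 4 * k.+1 * (N * x)) ?leq_addr //; lia.
move: Eu; rewrite /run; case: (iter u _ _) => [[[q l] a] r] /= [Eq _ _ _].
rewrite /halted /accepting !ffunE /= Eq /ctrl_delta inordK; last first.
  by rewrite szc; case: ifP => _; lia.
rewrite szc ifF /=; last by case: ifP => _; lia.
by split=> //; case: (b); rewrite ?eqxx // gtn_eqF.
Qed.

(** * Greedy elimination *)

Definition dom_in k n (H : {set {set 'I_n}}) (W : {set 'I_n}) (v : 'I_n) : Prop :=
  forall E : {set 'I_n}, #|E| = k -> v \in E -> E \subset W -> E \in H.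

Definition iso_in k n (H : {set {set 'I_n}}) (W : {set 'I_n}) (v : 'I_n) : Prop :=
  forall E : {set 'I_n}, #|E| = k -> v \in E -> E \subset W -> E \notin H.

Inductive eliminable k n (H : {set {set 'I_n}}) : {set 'I_n} -> Prop :=
  | elim_nil : eliminable k H set0
  | elim_cons (W : {set 'I_n}) v : v \in W -> dom_in k H W v \/ iso_in k H W v ->
      eliminable k H (W :\ v) -> eliminable k H W.

Lemma mem_tuple_uniq n (s : n.-tuple 'I_n) x : uniq s -> x \in s.
Proof.
move=> us; have /subset_leqif_cards[_ H] : [set y in s] \subset [set: 'I_n].
  by apply/subsetP=> y _; rewrite inE.
move: H; rewrite cardsE (card_uniqP us) size_tuple cardsT card_ord eqxx => /esym/eqP E.
by have := in_setT x; rewrite -E inE.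
Qed.

(** The vertex of [W] that comes last in the order works: [W] lies in its prefix, and both
    properties pass to smaller sets. So greedy choices never get stuck. *)
Lemma orderable_good k n (H : {set {set 'I_n}}) (W : {set 'I_n}) :
  orderable k H -> W != set0 -> exists2 v, v \in W & dom_in k H W v \/ iso_in k H W v.
Proof.
case=> s [us good] /set0Pn[x xW].
have /tnthP[i0 Ei0] := mem_tuple_uniq x us.
have Pi0 : tnth s i0 \in W by rewrite -Ei0.
case: (@arg_maxnP _ i0 (fun i => tnth s i \in W) val Pi0) => i iW imax.
exists (tnth s i) => //.
have sW : W \subset prefix_set s i.
  apply/subsetP=> y yW; have /tnthP[j Ej] := mem_tuple_uniq y us.
  by apply/imsetP; exists j => //; rewrite inE; apply: imax; rewrite -Ej.
case: (good i) => g; [left | right] => E cE iE EW; apply: g => //;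
  exact: subset_trans EW sW.
Qed.

(** Each removed vertex is appended at the end, so the set it was removed from consists of the
    entries up to it. *)
Lemma eliminable_seq k n (H : {set {set 'I_n}}) W : eliminable k H W ->
  exists s, [/\ uniq s, s =i W & forall p x q, s = p ++ x :: q ->
    dom_in k H [set y in rcons p x] x \/ iso_in k H [set y in rcons p x] x].
Proof.
elim=> [|{}W v vW good _ [s [us sW IH]]].
  by exists [::]; split=> [//|x|[]//]; rewrite inE.
exists (rcons s v); split.
- by rewrite rcons_uniq us sW !inE eqxx.
- move=> x; rewrite mem_rcons inE sW !inE; case: eqP => //= ->; by rewrite vW.
move=> p x q; case/lastP: q => [|q y].
  rewrite cats1 => /rcons_inj[<- <-].
  suff -> : [set y in rcons s v] = W by [].
  apply/setP=> x'; rewrite inE mem_rcons inE sW !inE.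
  by case: eqP => //= ->; rewrite vW.
by rewrite -rcons_cons -rcons_cat => /rcons_inj[/IH].
Qed.

Lemma eliminable_orderable k n (H : {set {set 'I_n}}) :
  eliminable k H [set: 'I_n] -> orderable k H.
Proof.
case/eliminable_seq=> s [us sT good].
have sz : size s == n.
  by rewrite -(card_uniqP us) -[X in _ == X]card_ord; apply/eqP/eq_card=> x; rewrite sT inE.
exists (Tuple sz); split=> // i; pose x := tnth (Tuple sz) i.
have lt_i : i < size s by rewrite (eqP sz).
have Ex : x = nth x s i := tnth_nth x (Tuple sz) i.
have E : [set y in rcons (take i s) x] = prefix_set (Tuple sz) i.
  rewrite {1}Ex -take_nth //; apply/setP=> y; rewrite inE; apply/idP/imsetP.
    move=> ys; have lt_y : index y (take i.+1 s) < size (take i.+1 s) by rewrite index_mem.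
    rewrite size_takel // in lt_y.
    have lt_yn : index y (take i.+1 s) < n by have := ltn_ord i; lia.
    exists (Ordinal lt_yn); first by rewrite inE.
    by rewrite (tnth_nth y) /= -(@nth_take i.+1) // nth_index.
  case=> j; rewrite inE => le_j ->; rewrite (tnth_nth x) /= -(@nth_take i.+1) //.
  by rewrite mem_nth // size_takel.
have := good (take i s) x (drop i.+1 s).
by rewrite {1}Ex -drop_nth // cat_take_drop E => /(_ erefl).
Qed.

(* [elim_run W r l f]: the greedy elimination can arrive at the vertex set [W]
   after removing [r] vertices, [l] being [k] times the number of those removed as
   dominating ones, and [f] recording a violation of [r <= l], if any. *)
Inductive elim_run k n (H : {set {set 'I_n}}) : {set 'I_n} -> nat -> nat -> bool -> Prop :=
  | run_start : elim_run k H setT 0 0 (~~ (k %| n))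
  | run_dom W r l f v : elim_run k H W r l f -> v \in W -> dom_in k H W v ->
      elim_run k H (W :\ v) r.+1 (l + k) (f || (l + k < r.+1))
  | run_iso W r l f v : elim_run k H W r l f -> v \in W -> iso_in k H W v ->
      elim_run k H (W :\ v) r.+1 l (f || (l < r.+1)).

Lemma elim_run_card k n (H : {set {set 'I_n}}) W r l f :
  elim_run k H W r l f -> r + #|W| = n.
Proof.
elim=> [|{}W {}r {}l {}f v _ IH vW _|{}W {}r {}l {}f v _ IH vW _].
- by rewrite add0n cardsT card_ord.
- by rewrite (cardsD1 v W) vW in IH; lia.
- by rewrite (cardsD1 v W) vW in IH; lia.
Qed.

Lemma elim_run_eliminable k n (H : {set {set 'I_n}}) W r l f :
  elim_run k H W r l f -> eliminable k H W -> eliminable k H setT.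
Proof.
elim=> [//|{}W {}r {}l {}f v _ IH vW g|{}W {}r {}l {}f v _ IH vW g] e.
- by apply: IH; apply: elim_cons e => //; left.
- by apply: IH; apply: elim_cons e => //; right.
Qed.

(** * Matchings missing a prescribed number of vertices *)

Definition deficient n (H : {set {set 'I_n}}) (W : {set 'I_n}) (b : nat) : Prop :=
  exists M : {set {set 'I_n}},
    [/\ M \subset H, trivIset M, cover M \subset W & #|W :\: cover M| = b].

Lemma deficient_card n (H : {set {set 'I_n}}) W : deficient H W #|W|.
Proof.
exists set0; split; rewrite ?sub0set //.
- by apply/trivIsetP=> A B; rewrite inE.
- by rewrite /cover big_set0 sub0set.
- by rewrite /cover big_set0 setD0.
Qed.

Lemma perfect_deficient k n (H : {set {set 'I_n}}) : 0 < k -> khypergraph k H ->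
  has_perfect_matching H <-> deficient H setT 0.
Proof.
move=> k0 kH; split=> [[M [MH /and3P[/eqP cM tM _]]]|[M [MH tM _ /eqP]]].
  by exists M; split=> //; rewrite ?subsetT // cM setDv cards0.
rewrite cards_eq0 setD_eq0 => cM; exists M; split=> //; apply/and3P; split=> //.
  by rewrite eqEsubset subsetT.
by apply/negP=> /(subsetP MH)/kH; rewrite cards0; lia.
Qed.

Lemma perfect_dvd k n (H : {set {set 'I_n}}) : khypergraph k H ->
  has_perfect_matching H -> k %| n.
Proof.
move=> kH [M [MH pM]].
have kM : {in M, forall E : {set 'I_n}, #|E| = k} by move=> E /(subsetP MH)/kH.
by have := card_uniform_partition kM pM; rewrite cardsT card_ord => ->; apply: dvdn_mull.
Qed.

Lemma deficient_mono n (H : {set {set 'I_n}}) (W : {set 'I_n}) v b :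
  v \in W -> deficient H (W :\ v) b -> deficient H W b.+1.
Proof.
move=> vW [M [MH tM cM E]]; exists M; split=> //.
  exact: subset_trans cM (subD1set _ _).
have vc : v \notin cover M by apply/negP=> /(subsetP cM); rewrite !inE eqxx.
rewrite (cardsD1 v) !inE vW vc -E add1n; congr _.+1.
by apply: eq_card => x; rewrite !inE andbCA.
Qed.

(** An edge through [v] inside [W] contradicts isolation, so every matching in [W] misses [v]. *)
Lemma deficient_iso k n (H : {set {set 'I_n}}) (W : {set 'I_n}) v b : khypergraph k H ->
  v \in W -> iso_in k H W v ->
  deficient H W b <-> 0 < b /\ deficient H (W :\ v) b.-1.
Proof.
move=> kH vW iso; split; last first.
  by case=> b0 /(deficient_mono vW); rewrite prednK.
case=> M [MH tM cM E].
have vc : v \notin cover M.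
  apply/negP=> /bigcupP[F FM vF]; have FH := subsetP MH _ FM.
  have := iso F (kH _ FH) vF; rewrite FH => /(_ _)/negP; apply=> //.
  by apply: subset_trans cM; apply: bigcup_sup.
move: E; rewrite (cardsD1 v) !inE vW vc => <-; split=> //.
exists M; split=> //.
  apply/subsetP=> x xc; rewrite !inE (subsetP cM) // andbT.
  by apply: contraNneq vc => <-.
by apply: eq_card => x; rewrite !inE andbCA.
Qed.

Lemma deficient_remove k n (H : {set {set 'I_n}}) (W : {set 'I_n}) (M : {set {set 'I_n}}) F :
    khypergraph k H -> M \subset H -> trivIset M -> cover M \subset W -> F \in M ->
  [/\ M :\ F \subset H, trivIset (M :\ F), cover (M :\ F) = cover M :\: F
    & #|W :\: cover (M :\ F)| = #|W :\: cover M| + k].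
Proof.
move=> kH MH tM cM FM.
have Ec : cover (M :\ F) = cover M :\: F.
  apply/setP=> x; rewrite inE; apply/bigcupP/andP.
    case=> E; rewrite !inE => /andP[nE EM] xE; split; last by apply/bigcupP; exists E.
    apply/negP=> xF; have /trivIsetP/(_ _ _ EM FM nE) := tM.
    by move/disjoint_setI0/setP/(_ x); rewrite !inE xE xF.
  case=> nF /bigcupP[E EM xE]; exists E => //; rewrite !inE EM andbT.
  by apply: contraNneq nF => <-.
split=> //.
- exact: subset_trans (subD1set _ _) MH.
- exact: trivIsetS (subD1set _ _) tM.
have FW : F \subset W by apply: subset_trans cM; apply: bigcup_sup.
have Fc : F \subset cover M by apply: bigcup_sup.
rewrite Ec -(kH F (subsetP MH _ FM)) -cardsUI.
rewrite [X in _ + #|pred_of_set X|](_ : _ = set0) ?cards0 ?addn0.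
  apply: eq_card => x; rewrite !inE; case xF: (x \in F) => //=; last by rewrite orbF.
  by rewrite (subsetP FW) // orbT.
apply/setP=> x; rewrite !inE; apply/negbTE/negP=> /andP[/andP[nx _] xF].
by case/negP: nx; apply: (subsetP Fc).
Qed.

Lemma subset_of_card n (A : {set 'I_n}) j : j <= #|A| ->
  exists2 B : {set 'I_n}, B \subset A & #|B| = j.
Proof.
move=> le_j; have : 0 < #|[set B : {set 'I_n} | (B \subset A) && (#|B| == j)]|.
  by rewrite cards_draws bin_gt0.
by case/card_gt0P=> B; rewrite inE => /andP[BA /eqP]; exists B.
Qed.

(** In one direction an edge is given up, the one covering [v] if there is one; in the other, [v]
    and [k.-1] missed vertices form an edge because [v] is dominating. *)
Lemma deficient_dom k n (H : {set {set 'I_n}}) (W : {set 'I_n}) v b : 0 < k -> khypergraph k H ->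
    v \in W -> dom_in k H W v -> b + k <= #|W| ->
  deficient H W b <-> deficient H (W :\ v) (b + k).-1.
Proof.
move=> k0 kH vW dom le_b; split=> [[M [MH tM cM E]]|[M [MH tM cM E]]].
  have [F FM vF] : exists2 F, F \in M & v \notin cover M \/ v \in F.
    case vc: (v \in cover M).
      by case/bigcupP: vc => F FM vF; exists F => //; right.
    (* The empty matching would miss all of [W], whereas [b < #|W|]. *)
    have /set0Pn[F FM] : M != set0.
      apply: contraTneq le_b => M0; rewrite -E M0 /cover big_set0 setD0; lia.
    by exists F => //; left.
  have [sH tM' Ec EW] := deficient_remove kH MH tM cM FM.
  have vc : v \notin cover (M :\ F).
    by rewrite Ec inE; case: vF => [/negbTE->|->]; rewrite ?andbF.
  exists (M :\ F); split=> //.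
    apply/subsetP=> x xc; rewrite !inE; apply/andP; split.
      by apply: contraNneq vc => <-.
    by move: xc; rewrite Ec inE => /andP[_ /(subsetP cM)].
  move: EW; rewrite E (cardsD1 v) !inE vW vc /= => <- /=.
  by apply: eq_card => x; rewrite !inE andbCA.
have [|B sB cB] := @subset_of_card n ((W :\ v) :\: cover M) k.-1; first lia.
have vB : v \notin B.
  by apply/negP=> /(subsetP sB); rewrite !inE eqxx andbF.
have cF : #|v |: B| = k by rewrite cardsU1 vB cB; lia.
have sF : v |: B \subset W.
  rewrite subUset sub1set vW; apply: subset_trans sB _.
  by apply/subsetP=> x; rewrite !inE => /and3P[].
have FH : v |: B \in H by apply: dom => //; rewrite !inE eqxx.
have dF : [disjoint v |: B & cover M].
  apply/pred0P=> x /=; rewrite !inE; apply/negbTE/negP=> /andP[xF xc].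
  case/orP: xF => [/eqP Ex|/(subsetP sB)]; last by rewrite !inE xc.
  by have := subsetP cM _ xc; rewrite !inE Ex eqxx.
have FM : v |: B \notin M.
  apply/negP=> FM; have /pred0P/(_ v) := dF; rewrite /= !inE eqxx /=.
  by move/negP; apply; apply/bigcupP; exists (v |: B) => //; rewrite !inE eqxx.
have Ec : cover (v |: B |: M) = (v |: B) :|: cover M by rewrite /cover big_setU1.
exists (v |: B |: M); split.
- by rewrite subUset sub1set FH MH.
- apply/trivIsetP=> A C; rewrite !inE => /orP[/eqP->|AM] /orP[/eqP->|CM] nAC.
  + by rewrite eqxx in nAC.
  + by apply: disjointWr dF; apply: bigcup_sup.
  + by rewrite disjoint_sym; apply: disjointWr dF; apply: bigcup_sup.
  + by move/trivIsetP: tM; apply.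
- by rewrite Ec subUset sF; apply: subset_trans cM (subD1set _ _).
have -> : W :\: cover (v |: B |: M) = ((W :\ v) :\: cover M) :\: B.
  apply/setP=> x; rewrite Ec !inE negb_or.
  by case: (x == v); case: (x \in B); case: (x \in cover M); case: (x \in W).
by rewrite cardsD (setIidPr sB) E cB; lia.
Qed.

(** While the flag is unset, the deficiency still to be met is [l - r]. Once [n <= l], no later
    check can fail, as [r <= n]; this case stands apart because [l - r] may then exceed [#|W|]. *)
Lemma elim_run_perfect k n (H : {set {set 'I_n}}) W r l f :
    0 < k -> khypergraph k H -> elim_run k H W r l f ->
  [/\ k %| l, ~~ f -> r <= l, ~~ f -> k %| n & has_perfect_matching H <->
      ~~ f /\ (n <= l \/ deficient H W (l - r))].
Proof.
move=> k0 kH; elim=> [|{}W {}r {}l {}f v run [kl fl fn IH] vW g|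
                        {}W {}r {}l {}f v run [kl fl fn IH] vW g].
- split; rewrite ?dvdn0 ?negbK // (perfect_deficient k0 kH) sub0n.
  split=> [d|[kn [n0|//]]].
    by split; [apply: (perfect_dvd kH); apply/(perfect_deficient k0 kH) | right].
  have -> : 0 = #|[set: 'I_n]| by rewrite cardsT card_ord; lia.
  exact: deficient_card.
- have cW := elim_run_card run.
  have cW1 := cardsD1 v W; rewrite vW in cW1.
  split; [by rewrite dvdn_add | by rewrite negb_or; lia
         | by rewrite negb_or => /andP[/fn] |].
  rewrite IH negb_or -leqNgt; case: (boolP f) => [_|nf] /=; first by split=> -[].
  have le_rl := fl nf; have kn := fn nf.
  have -> : r < l + k by lia.
  have [le_nl|lt_ln] := leqP n l.
    by split=> _; split=> //; left; lia.
  (* Both [l] and [n] are multiples of [k], so [l < n] leaves room for a further [k]; this yields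
     the size hypothesis of [deficient_dom]. *)
  have le_lk : l + k <= n.
    case/dvdnP: kl lt_ln => a ->; case/dvdnP: kn => c ->.
    by rewrite ltn_mul2r k0 -mulSnr leq_mul2r => /= ->; rewrite orbT.
  have D := @deficient_dom k n H W v (l - r) k0 kH vW g.
  rewrite (_ : l + k - r.+1 = (l - r + k).-1); last lia.
  split=> -[_ [h|d]]; [lia | split=> // | split=> // | split=> //]; right.
  + by apply/D => //; lia.
  (* Here [l + k = n], so the deficiency asked for is [#|W :\ v|], met by the empty matching. *)
  + apply/D; first lia.
    rewrite (_ : _.-1 = #|W :\ v|); last lia.
    exact: deficient_card.
  + by apply/D => //; lia.
- have cW := elim_run_card run.
  have cW1 := cardsD1 v W; rewrite vW in cW1.
  split=> //; [by rewrite negb_or; lia | by rewrite negb_or => /andP[/fn] |].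
  rewrite IH negb_or -leqNgt; case: (boolP f) => [_|nf] /=; first by split=> -[].
  have [le_nl|lt_ln] := leqP n l.
    by split=> _; split=> //; [lia | left | left].
  have D := deficient_iso (l - r) kH vW g.
  split=> -[h1 [|d]]; try lia.
    by case/D: d => h d; split; [lia | right; rewrite subnS].
  by split=> //; right; apply/D; split; [lia | rewrite -subnS].
Qed.

(** At the end [r = n], so an unset flag gives [n <= l]. *)
Lemma elim_run_set0 k n (H : {set {set 'I_n}}) r l f :
    0 < k -> khypergraph k H -> elim_run k H set0 r l f ->
  has_perfect_matching H <-> ~~ f.
Proof.
move=> k0 kH run; have := elim_run_card run; rewrite cards0 addn0 => Er.
have [_ fl _ ->] := elim_run_perfect k0 kH run.
by split=> [[]//|nf]; split=> //; left; rewrite -Er fl.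
Qed.

(** * The program *)

Notation "c1 ;; c2" := (Seq c1 c2) (at level 61, right associativity).

(** [rZ] stays 0; [rU], [rV], [rP] count rounds, vertices and input positions; [rRem] and [rLim]
    hold the [r] and [l] of [elim_run]. The register [rX k.-1] holds [n] and bounds the nested
    counters below it. *)
Definition rZ := 0.
Definition rU := 1.
Definition rV := 2.
Definition rP := 3.
Definition rCur := 4.
Definition rDeg := 5.
Definition rCnt := 6.
Definition rRem := 7.
Definition rLim := 8.
Definition rCyc := 9.
Definition rK := 10.
Definition rX (j : nat) := 11 + j.

(* The arrays 1, 2 and 3 hold the input tokens; [fOk], [fHas], [fFail], [fFound]
   and [fGood] are flags, stored at index 0. *)
Definition aAlive := 0.
Definition fOk := 4.
Definition fHas := 5.
Definition fFail := 6.
Definition fFound := 7.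
Definition fGood := 8.

Definition flag (f : nat) (b : bool) : cmd := Op (Put f rZ b).

Definition incs (r j : nat) : cmd := iter j (Seq (Op (Inc r))) Skip.

(* [rCur] accumulates the unary index being read; [fOk] and [fHas] tell whether the
   part of the current edge read so far is alive, resp. contains the vertex [rV]. The
   header 1^n 3 is scanned like an edge without vertices. *)
Definition scan_cmd : cmd :=
  If (Rd 1 rP) (Op (Inc rCur))
    (If (Rd 2 rP)
      (If (Rd aAlive rCur) Skip (flag fOk false) ;;
       If (Same rCur rV) (flag fHas true) Skip ;; Op (Zero rCur))
      (If (Rd fOk rZ) (If (Rd fHas rZ) (Op (Inc rDeg)) Skip) Skip ;;
       Op (Zero rCur) ;; flag fOk true ;; flag fHas false)).

Definition deg_cmd : cmd :=
  Op (Zero rDeg) ;; Op (Zero rCur) ;; flag fOk true ;; flag fHas false ;;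
  For rP scan_cmd.

(* Increments [rCnt] once for each [j]-set of alive vertices below [rX j] and
   distinct from [rV]. *)
Fixpoint nest (j : nat) : cmd :=
  if j is i.+1 then
    For (rX i)
      (If (Rd aAlive (rX i))
        (If (Same (rX i) rV) Skip (If (Less (rX i) (rX j)) (nest i) Skip)) Skip)
  else Op (Inc rCnt).

(** Acts only up to the first token 3, which ends the header; [n] modulo [k] comes from the counter
    [rCyc], which wraps around at [rK]. *)
Definition init_loop (rN : nat) : cmd :=
  If (Rd fFound rZ) Skip
    (If (Rd 3 rP) (flag fFound true)
      (Op (Put aAlive rP true) ;; Op (Inc rN) ;; Op (Inc rCyc) ;;
       If (Same rCyc rK) (Op (Zero rCyc)) Skip)).

Definition init_cmd (k : nat) : cmd :=
  Op (Zero rZ) ;; Op (Zero (rX k.-1)) ;; Op (Zero rCyc) ;; Op (Zero rRem) ;;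
  Op (Zero rLim) ;; Op (Zero rK) ;; incs rK k ;;
  For rP (init_loop (rX k.-1)) ;;
  If (Same rCyc rZ) Skip (flag fFail true).

(** [rLim] may run off the tape, but [rRem] never exceeds [n], so the comparison stays exact. *)
Definition remove_cmd : cmd :=
  Op (Put aAlive rV false) ;; Op (Inc rRem) ;;
  If (Less rLim rRem) (flag fFail true) Skip.

(** If no [k]-set of alive vertices contains the vertex, it is both dominating and isolating, and is
    removed as dominating. *)
Definition vertex_cmd (k : nat) : cmd :=
  If (Rd aAlive rV)
    (deg_cmd ;; Op (Zero rCnt) ;; nest k.-1 ;;
     If (Same rDeg rCnt) (incs rLim k ;; remove_cmd)
       (If (Same rDeg rZ) remove_cmd Skip))
    Skip.

Definition main_cmd (k : nat) : cmd := init_cmd k ;; For rU (For rV (vertex_cmd k)).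

(** Acceptance needs a test that succeeds, so the absence of [fFail] is turned into the flag
    [fGood]. *)
Definition matching_cmd (k : nat) : cmd :=
  main_cmd k ;; If (Rd fFail rZ) Skip (flag fGood true).

(** * What the counting loops compute *)

Lemma reg_incs N r j m r' :
  reg (eval N (incs r j) m) r' = if r' == r then reg m r + j else reg m r'.
Proof.
elim: j m => [|j IH] m /=; first by rewrite addn0; case: eqP => // ->.
by rewrite IH /= /upd eqxx addSnnS; case: eqP.
Qed.

Lemma writes_incs r r' j : writes r' (incs r j) = (0 < j) && (r' == r).
Proof. by elim: j => //= j ->; case: (_ == _); rewrite ?andbF. Qed.

Lemma puts_incs b r j : puts b (incs r j) = false.
Proof. by elim: j. Qed.

Lemma writes_nest r j : writes r (nest j) = (r == rCnt) || (rX 0 <= r < rX j).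
Proof.
elim: j => [|j IH] /=; first by rewrite /rX /rCnt; lia.
by rewrite orbF IH /rX /rCnt; lia.
Qed.

Lemma puts_nest b j : puts b (nest j) = false.
Proof. by elim: j => //= j ->. Qed.

Lemma wf_incs r j : wf (incs r j).
Proof. by elim: j. Qed.

Lemma wf_nest j : wf (nest j).
Proof. by elim: j => //= j ->; rewrite orbF writes_nest /rX /rCnt; lia. Qed.

(** [scan_cmd] as a pure function to be folded over the tokens; the components mirror [rCur], [fOk],
    [fHas] and [rDeg]. *)
Definition scan (a : nat -> bool) (v : nat) (s : nat * bool * bool * nat) (t : nat) :=
  let: (cur, ok, has, d) := s in
  if t == 1 then (cur.+1, ok, has, d)
  else if t == 2 then (0, ok && a cur, has || (cur == v), d)
  else (0, true, false, d + (ok && has)).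

Lemma deg_cmdP N w m : 0 < N -> size w = N -> reg m rZ = 0 ->
    (forall t i, 0 < t < 4 -> arr m t i = (t == nth 0 w i)) ->
  reg (eval N deg_cmd m) rDeg =
  (foldl (scan (arr m aAlive) (reg m rV)) (0, true, false, 0) w).2.
Proof.
move=> N0 sw Z0 tok.
pose st i := foldl (scan (arr m aAlive) (reg m rV)) (0, true, false, 0) (take i w).
pose P i m' := [/\ reg m' rZ = 0, reg m' rV = reg m rV, arr m' aAlive = arr m aAlive,
      arr m' 1 = arr m 1 & arr m' 2 = arr m 2] /\
  let: (cur, ok, has, d) := st i in
  [/\ reg m' rCur = cur, arr m' fOk 0 = ok, arr m' fHas 0 = has, reg m' rDeg = d
    & cur <= i].
suff : P N (eval N deg_cmd m).
  rewrite /P /st take_oversize ?sw //.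
  by case: (foldl _ _ _) => [[[c o] h] d] [_ []].
apply: (@eval_ForP N rP scan_cmd P (exec_op (Put fHas rZ false) (exec_op
  (Put fOk rZ true) (exec_op (Zero rCur) (exec_op (Zero rDeg) m))))) => //.
  by rewrite /P /st take0 /= /upd /= Z0.
move=> i m' lt_iN EP [[EZ EV EA E1 E2] Hst]; split.
  by split; rewrite ?exec_op_reg ?exec_op_arr ?eval_reg ?eval_arr.
rewrite /st (take_nth 0) ?sw // foldl_rcons -/(st i).
case: (st i) Hst => [[[c o] h] d] [Ec Eo Eh Ed le_c].
(* [rCur] is at most the number of tokens read, so it stays on the tape. *)
have lt_cN : c < N by lia.
rewrite /scan_cmd [eval _ _ _]/= EP E1 (tok 1) // lt_iN andbT [1 == _]eq_sym /scan.
case: eqP => [_|n1]; first by rewrite /= /upd /= Ec.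
rewrite E2 (tok 2) // andbT [2 == _]eq_sym.
case: eqP => [_|n2].
  rewrite Ec EA lt_cN andbT.
  case: (arr m aAlive c) => /=; rewrite Ec EV lt_cN andbT;
  by case: (c == _); rewrite /= /upd /= ?EZ ?Eo ?Eh ?andbT ?andbF ?orbT ?orbF.
rewrite EZ Eo N0 andbT.
case: o Eo => Eo /=; rewrite ?EZ ?Eh ?N0 ?andbT; last by rewrite /= /upd /= EZ /= addn0.
by case: h Eh => Eh; rewrite /= /upd /= ?EZ /= ?Ed ?addn1 ?addn0.
Qed.
Lemma nestP N j m : reg m (rX j) < N ->
  reg (eval N (nest j) m) rCnt = reg m rCnt +
    'C(count (fun y => arr m aAlive y && (y != reg m rV)) (iota 0 (reg m (rX j))), j).
Proof.
elim: j m => [|j IH] m lt_b; first by rewrite /= /upd /= bin0 addn1.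
set A := fun y => _; set b := reg m (rX j.+1) in lt_b *.
(* Rounds from [b] on contribute nothing, hence [minn i b]. *)
pose P i m' := [/\ reg m' rV = reg m rV, reg m' (rX j.+1) = b,
    arr m' aAlive = arr m aAlive
  & reg m' rCnt = reg m rCnt + 'C(count A (iota 0 (minn i b)), j.+1)].
suff [_ _ _ ->] : P N (eval N (nest j.+1) m) by rewrite (minn_idPr (ltnW lt_b)).
have nX r : r != rX j -> ~~ op_writes r (Inc (rX j)) by [].
have neqV : rV != rX j by [].
have neqC : rCnt != rX j by [].
have neqX : rX j.+1 != rX j by rewrite /rX; lia.
have nV : ~~ writes rV (nest j) by rewrite writes_nest.
have nXS : ~~ writes (rX j.+1) (nest j) by rewrite writes_nest /rX /rCnt; lia.
apply: eval_ForP.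
- by rewrite /= orbF writes_nest /rX /rCnt; lia.
- split; rewrite ?exec_op_reg //; last by rewrite min0n bin0n addn0.
move=> i m' lt_i Ei [EV Eb EA EC].
set body := If _ _ _.
have -> : eval N body m' = if A i && (i < b) then eval N (nest j) m' else m'.
  rewrite /body /= Ei EV Eb EA lt_i lt_b !andbT /A.
  by case: (arr m aAlive i); case: eqP; case: (i < b).
set m1 := if _ then _ else _.
have F r : r != rX j -> ~~ writes r (nest j) ->
    reg (exec_op (Inc (rX j)) m1) r = reg m' r.
  by move=> /nX h1 h2; rewrite (exec_op_reg _ h1) /m1; case: ifP => _; rewrite ?(eval_reg _ _ h2).
split.
- by rewrite F.
- by rewrite (F _ neqX nXS).
- by rewrite exec_op_arr // /m1; case: ifP => _; rewrite ?eval_arr // puts_nest.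
rewrite (exec_op_reg _ (nX _ neqC)) /m1.
have [lt_ib|le_bi] := ltnP i b; last first.
  by rewrite andbF EC (minn_idPr le_bi) (minn_idPr (leqW le_bi)).
rewrite (minn_idPl lt_ib) (minn_idPl (ltnW lt_ib)) in EC *.
rewrite andbT -[i.+1]addn1 iotaD count_cat /= addn0 add0n.
case Ai: (A i); last by rewrite EC addn0.
by rewrite IH ?Ei // EC EV EA -/A addn1 binS addnA.
Qed.

Lemma foldl_scan_ones a v j c o h d :
  foldl (scan a v) (c, o, h, d) (nseq j 1) = (c + j, o, h, d).
Proof. by elim: j c => [|j IH] c /=; rewrite ?addn0 // IH addSnnS. Qed.

Lemma foldl_scan_edge n (W E : {set 'I_n}) (a : nat -> bool) (v : 'I_n) d :
    (forall x : 'I_n, a x = (x \in W)) ->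
  foldl (scan a v) (0, true, false, d) (enc_edge E) =
  (0, true, false, d + ((v \in E) && (E \subset W))).
Proof.
move=> aW; rewrite /enc_edge foldl_cat.
have H s o h : foldl (scan a v) (0, o, h, d)
    (flatten [seq rcons (nseq (val x) 1) 2 | x <- s]) =
    (0, o && all (mem W) s, h || (v \in s), d).
  elim: s o h => [|x s IH] o h /=; first by rewrite andbT orbF.
  rewrite foldl_cat foldl_rcons foldl_scan_ones /= IH add0n aW -andbA in_cons.
  by rewrite -orbA (eq_sym v).
rewrite H /= mem_enum andbC; congr (_, _ + nat_of_bool (_ && _)).
by apply/allP/subsetP=> sEW x; have := sEW x; rewrite mem_enum.
Qed.

(** * Dominating and isolating vertices recognised by degree *)

Definition scan_deg n (H : {set {set 'I_n}}) (W : {set 'I_n}) (v : 'I_n) : nat :=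
  #|[set E in H | (v \in E) && (E \subset W)]|.

Lemma foldl_scan_enc n (H : {set {set 'I_n}}) es (W : {set 'I_n}) a (v : 'I_n) :
    edge_list H es -> (forall x : 'I_n, a (val x) = (x \in W)) ->
  (foldl (scan a v) (0, true, false, 0) (enc_hypergraph es)).2 = scan_deg H W v.
Proof.
case=> ues <- aW; rewrite /enc_hypergraph foldl_cat foldl_rcons foldl_scan_ones /=.
have G (s : seq {set 'I_n}) d : foldl (scan a v) (0, true, false, d) (flatten [seq enc_edge E | E <- s]) =
    (0, true, false, d + count (fun E : {set 'I_n} => (v \in E) && (E \subset W)) s).
  elim: s d => [|E s IH] d /=; first by rewrite addn0.
  by rewrite foldl_cat (foldl_scan_edge _ _ _ aW) IH addnA.
rewrite G /= -size_filter -(card_uniqP (filter_uniq _ ues)).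
by apply: eq_card => E; rewrite !inE mem_filter andbC.
Qed.

Lemma card_sets_through k n (W : {set 'I_n}) v : 0 < k -> v \in W ->
  #|[set E : {set 'I_n} | [&& #|E| == k, v \in E & E \subset W]]| =
  'C(#|W :\ v|, k.-1).
Proof.
move=> k0 vW; rewrite -cards_draws.
set D := [set B : {set 'I_n} | (B \subset W :\ v) && (#|B| == k.-1)].
have Dv B : B \in D -> v \notin B.
  by rewrite inE => /andP[/subsetP sB _]; apply/negP=> /sB; rewrite !inE eqxx.
rewrite -(@card_in_imset _ _ (fun B => v |: B) D); last first.
  by move=> B C /Dv vB /Dv vC /(congr1 (fun E => E :\ v)); rewrite !setU1K.
apply: eq_card => E; rewrite inE; apply/and3P/imsetP.
  case=> /eqP cE vE sE; exists (E :\ v); last by rewrite setD1K.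
  by rewrite inE setSD //= -cE (cardsD1 v E) vE.
case=> B BD ->; have vB := Dv _ BD; move: BD; rewrite inE => /andP[sB /eqP cB].
split; first by rewrite cardsU1 vB cB; lia.
  by rewrite !inE eqxx.
by rewrite subUset sub1set vW; apply: subset_trans sB (subD1set _ _).
Qed.

(** The edges counted are among the [k]-sets through [v] inside [W]; equal cardinality forces
    equality of the two families. *)
Lemma scan_deg_dom k n (H : {set {set 'I_n}}) (W : {set 'I_n}) v : 0 < k ->
    khypergraph k H -> v \in W ->
  scan_deg H W v = 'C(#|W :\ v|, k.-1) <-> dom_in k H W v.
Proof.
move=> k0 kH vW; rewrite -card_sets_through // /scan_deg.
set T := [set E in H | _]; set S := [set E | _].
have sTS : T \subset S.
  by apply/subsetP=> E; rewrite !inE => /and3P[/kH-> -> ->]; rewrite eqxx.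
split=> [eq_c E cE vE EW|dom].
  have : E \in S by rewrite inE cE eqxx vE EW.
  have /eqP <- : T == S by rewrite eqEcard sTS eq_c leqnn.
  by rewrite inE => /andP[].
apply/eqP; rewrite eqn_leq subset_leq_card //=; apply/subset_leq_card/subsetP=> E.
by rewrite !inE => /and3P[/eqP cE vE EW]; rewrite vE EW dom.
Qed.

Lemma scan_deg_iso k n (H : {set {set 'I_n}}) (W : {set 'I_n}) v :
  khypergraph k H -> scan_deg H W v = 0 <-> iso_in k H W v.
Proof.
move=> kH; split=> [/cards0_eq T0 E _ vE EW|iso].
  by have /setP/(_ E) := T0; rewrite !inE vE EW !andbT => ->.
apply/eqP; rewrite cards_eq0; apply/eqP/setP=> E; rewrite !inE.
apply/negbTE/negP=> /and3P[EH vE EW].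
by have := iso E (kH _ EH) vE EW; rewrite EH.
Qed.

(** The encoding of each edge ends with a token 3 of its own, so a degree is always a value visible
    on the tape. *)
Lemma scan_deg_leq n (H : {set {set 'I_n}}) (es : seq {set 'I_n}) W v :
  edge_list H es -> scan_deg H W v < size (enc_hypergraph es).
Proof.
case=> ues <-; rewrite /enc_hypergraph size_cat size_rcons size_nseq.
apply: (@leq_ltn_trans (size es)).
  rewrite -(card_uniqP ues); apply/subset_leq_card/subsetP=> E.
  by rewrite !inE => /andP[].
suff : size es <= size (flatten [seq enc_edge E | E <- es]) by lia.
elim: (es) => //= E s IH; rewrite size_cat {1}/enc_edge size_cat /= addn1 addSn ltnS.
exact: leq_trans IH (leq_addl _ _).
Qed.

(** * The program follows the greedy elimination *)

Definition vals n (W : {set 'I_n}) : seq nat := [seq val x | x <- enum W].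

Lemma mem_vals n (W : {set 'I_n}) (x : 'I_n) : (val x \in vals W) = (x \in W).
Proof. by rewrite mem_map ?mem_enum //; apply: val_inj. Qed.

Lemma valsP n (W : {set 'I_n}) i : reflect (exists2 x : 'I_n, x \in W & i = val x) (i \in vals W).
Proof.
apply: (iffP mapP) => -[x xW ->]; exists x => //; last by rewrite mem_enum.
by rewrite mem_enum in xW.
Qed.

Lemma count_vals n (W : {set 'I_n}) (v : 'I_n) :
  count (fun y => (y \in vals W) && (y != val v)) (iota 0 n) = #|W :\ v|.
Proof.
rewrite -val_enum_ord count_map cardE [enum (W :\ v)]/enum_mem -enumT size_filter.
by apply: eq_count => x /=; rewrite mem_vals !inE andbC.
Qed.

(** The memory mirrors a state of [elim_run]. The tokens are kept intact because every degree count
    rereads the input. *)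
Definition represents n (w : seq nat) (rN : nat) (m : memory) (W : {set 'I_n})
    (r l : nat) (f : bool) : Prop :=
  [/\ reg m rZ = 0, reg m rN = n, reg m rRem = r & reg m rLim = l] /\
  [/\ arr m fFail 0 = f, forall i, arr m aAlive i = (i \in vals W)
    & forall t i, 0 < t < 4 -> arr m t i = (t == nth 0 w i)].

Lemma modnS_cycle k i : 0 < k ->
  i.+1 %% k = if (i %% k).+1 == k then 0 else (i %% k).+1.
Proof.
move=> k0; rewrite -[i.+1]addn1 -modnDml addn1; case: eqP => [->|ne].
  by rewrite modnn.
by rewrite modn_small //; have := ltn_pmod i k0; lia.
Qed.

Lemma init_loopP N k n w rN m i : 0 < k -> n < N ->
    (forall i, i < n -> nth 0 w i = 1) -> nth 0 w n = 3 -> 10 < rN ->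
    i < N -> reg m rP = i -> reg m rZ = 0 -> reg m rK = k ->
    (forall i, arr m 3 i = (3 == nth 0 w i)) ->
    reg m rN = minn i n -> reg m rCyc = minn i n %% k ->
    arr m fFound 0 = (n < i) -> (forall x, arr m aAlive x = (x < minn i n)) ->
  let m' := eval N (init_loop rN) m in
  [/\ reg m' rN = minn i.+1 n, reg m' rCyc = minn i.+1 n %% k,
      arr m' fFound 0 = (n < i.+1) & forall x, arr m' aAlive x = (x < minn i.+1 n)].
Proof.
move=> k0 ltnN w1 w3 rN10 lt_iN EP EZ EK E3 EN EC EF EA.
have N0 : 0 < N by lia.
have [lt_ni|le_in] := ltnP n i.
  have -> : eval N (init_loop rN) m = m by rewrite /= EZ EF lt_ni N0.
  rewrite (minn_idPr (ltnW lt_ni)) in EN EC EA.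
  have E : minn i.+1 n = n by lia.
  by split; rewrite ?E // EF; lia.
rewrite (minn_idPl le_in) in EN EC EA.
have t0 : test_op N (Rd fFound rZ) m = false by rewrite /= EZ EF; lia.
have t3 : test_op N (Rd 3 rP) m = (i == n).
  rewrite /= EP E3 lt_iN andbT; case: (i =P n) => [->|ne]; first by rewrite w3.
  by rewrite w1 //; lia.
pose m1 := exec_op (Inc rCyc) (exec_op (Inc rN) (exec_op (Put aAlive rP true) m)).
have -> : eval N (init_loop rN) m =
    if i == n then exec_op (Put fFound rZ true) m
    else if test_op N (Same rCyc rK) m1 then exec_op (Zero rCyc) m1 else m1.
  by rewrite -t3 /init_loop [LHS]/= -/(test_op N (Rd fFound rZ) m) t0.
case: eqP => [Ei|ne].
  have E : minn i.+1 n = i by lia.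
  split; rewrite ?E //; by rewrite /= /upd /= EZ Ei ltnSn.
have E : minn i.+1 n = i.+1 by lia.
have nN r : r < 11 -> (r == rN = false) * (rN == r = false) by move=> ?; split; lia.
have N1 : reg m1 rN = i.+1 by rewrite /= /upd eqxx nN // EN.
have C1 : reg m1 rCyc = (i %% k).+1 by rewrite /= /upd /= nN // EC.
have K1 : reg m1 rK = k by rewrite /= /upd /= nN // EK.
have A1 x : arr m1 aAlive x = (x < i.+1).
  by rewrite /= /upd EP /=; case: eqP => [->|ne_x]; rewrite ?EA; lia.
have F1 : arr m1 fFound 0 = (n < i.+1) by rewrite /= /upd /= EF; lia.
have -> : test_op N (Same rCyc rK) m1 = ((i %% k).+1 == k).
  rewrite [LHS](_ : _ = (reg m1 rCyc == reg m1 rK) && (reg m1 rCyc < N)) // C1 K1.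
  (* The wrapping counter is at most [n], hence on the tape, even if [k] is not. *)
  by rewrite [_ < N](_ : _ = true) ?andbT //; have := leq_mod i k; lia.
have EC1 := modnS_cycle i k0; rewrite E.
case: eqP EC1 => [_|_] EC1; split; rewrite ?EC1 ?C1 //.
by rewrite exec_op_reg // [op_writes _ _]nN.
Qed.

Lemma init_cmdP k n w : 0 < k -> n < size w -> (forall i, i < n -> nth 0 w i = 1) ->
    nth 0 w n = 3 -> all (fun t => 0 < t < 4) w ->
  represents w (rX k.-1) (eval (size w) (init_cmd k) (init_memory w)) [set: 'I_n] 0 0
    (~~ (k %| n)).
Proof.
move=> k0 ltnN w1 w3 wok; rewrite /init_cmd; set N := size w.
(* Only the disjointness of [rX k.-1] from the fixed registers matters, so it becomes an arbitrary
   register above 10. *)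
move: (rX k.-1) (isT : 10 < rX k.-1) => rN rN10.
have nN r : r < 11 -> (r == rN = false) * (rN == r = false) by move=> ?; split; lia.
have N0 : 0 < N by rewrite /N; lia.
(* Tokens are at most 3, so the flags start out unset. *)
have flag0 b : 3 < b -> arr (init_memory w) b 0 = false.
  by move=> b3 /=; have := all_nthP 0 wok _ N0; lia.
set m0 := eval N (incs rK k) (exec_op (Zero rK) (exec_op (Zero rLim) (exec_op (Zero rRem)
  (exec_op (Zero rCyc) (exec_op (Zero rN) (exec_op (Zero rZ) (init_memory w))))))).
have A0 b : arr m0 b = arr (init_memory w) b by rewrite eval_arr // puts_incs.
have [Z0 C0 R0 L0 K0] : [/\ reg m0 rZ = 0, reg m0 rCyc = 0, reg m0 rRem = 0,
    reg m0 rLim = 0 & reg m0 rK = k].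
  by rewrite /m0 !reg_incs /= /upd /= nN.
have EN0 : reg m0 rN = 0.
  have nN2 r : r < 11 -> (rN == r) = false by move=> ?; lia.
  by rewrite reg_incs /= /upd (nN2 rK) ?(nN2 rLim) ?(nN2 rRem) ?(nN2 rCyc) ?eqxx.
pose P i m' := [/\ reg m' rZ = 0, reg m' rN = minn i n, reg m' rCyc = minn i n %% k,
    reg m' rK = k & arr m' 3 = arr (init_memory w) 3] /\
  (arr m' fFound 0 = (n < i) /\ forall x, arr m' aAlive x = (x < minn i n)).
have nw r : r < 11 -> r != rCyc -> ~~ writes r (init_loop rN).
  by move=> r11 r9; rewrite /= (negbTE r9) nN.
set m1 := eval N (For rP (init_loop rN)) m0.
have [[Z1 N1 C1 K1 _] [_ A1]] : P N m1.
  apply: eval_ForP; first exact: nw.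
    split; split; rewrite ?exec_op_reg ?exec_op_arr ?nN // ?Z0 ?EN0 ?C0 ?min0n ?mod0n //.
    - by rewrite [op_writes _ _]nN.
    - by rewrite A0 flag0.
    - by move=> x; rewrite A0.
  move=> i m' lt_iN EP [[EZ EN EC EK E3] [EF EA]].
  have E3' j : arr m' 3 j = (3 == nth 0 w j) by rewrite E3.
  have [a b c d] := init_loopP k0 ltnN w1 w3 rN10 lt_iN EP EZ EK E3' EN EC EF EA.
  split=> //; split=> //.
  - by rewrite exec_op_reg // eval_reg // nw.
  - by rewrite exec_op_reg ?a //= nN.
  - by rewrite exec_op_reg // eval_reg // nw.
  - by rewrite exec_op_arr // eval_arr.
rewrite (minn_idPr (ltnW ltnN)) in N1 C1 A1.
have ES : eval N (Op (Zero rZ) ;; Op (Zero rN) ;; Op (Zero rCyc) ;; Op (Zero rRem) ;;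
    Op (Zero rLim) ;; Op (Zero rK) ;; incs rK k ;; For rP (init_loop rN) ;;
    If (Same rCyc rZ) Skip (flag fFail true)) (init_memory w) =
    if test_op N (Same rCyc rZ) m1 then m1 else exec_op (Put fFail rZ true) m1 by [].
rewrite ES (_ : test_op _ _ _ = (k %| n)); last by rewrite /= C1 Z1; lia.
have R1 r : r < 11 -> r != rP -> r != rCyc -> reg m1 r = reg m0 r.
  by move=> r11 r3 r9; rewrite eval_reg //= (negbTE r3) nw.
have T1 b : b != aAlive -> b != fFound -> arr m1 b = arr (init_memory w) b.
  by move=> b0 b7; rewrite eval_arr ?A0 //= (negbTE b7) (negbTE b0).
have EA i : arr m1 aAlive i = (i \in vals [set: 'I_n]).
  rewrite A1; apply/idP/valsP => [lt_in|[x _ ->]]; last exact: ltn_ord.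
  by exists (Ordinal lt_in); rewrite ?inE.
have ET t i : 0 < t < 4 -> arr m1 t i = (t == nth 0 w i).
  by case/andP=> t0 t4; rewrite T1 /= ?t0 // /aAlive /fFound; lia.
have Rem1 : reg m1 rRem = 0 by rewrite R1.
have Lim1 : reg m1 rLim = 0 by rewrite R1.
have Fail1 : arr m1 fFail 0 = false by rewrite T1 // flag0.
case: (k %| n); split; split=> //.
- by rewrite /= /upd /= Z1.
- by move=> t i t4; rewrite exec_op_arr ?ET //= /fFail; lia.
Qed.

Lemma remove_cmdP n N w rN m (W : {set 'I_n}) r l f (x : 'I_n) : 10 < rN ->
    represents w rN m W r l f -> reg m rV = val x -> r.+1 < N ->
  represents w rN (eval N remove_cmd m) (W :\ x) r.+1 l (f || (l < r.+1)).
Proof.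
move=> rN10 [[EZ EN ER EL] [EF EA ET]] EV lt_rN.
pose m1 := exec_op (Inc rRem) (exec_op (Put aAlive rV false) m).
have nN : rN != rRem by rewrite /rRem; lia.
have N1 : reg m1 rN = n by rewrite /= /upd (negbTE nN).
have R1 : reg m1 rRem = r.+1 by rewrite /= /upd /= ER.
have A1 i : arr m1 aAlive i = (i \in vals (W :\ x)).
  rewrite /= /upd /= EV EA; case: eqP => [->|ne].
    by rewrite mem_vals !inE eqxx.
  apply/valsP/valsP=> -[y yW Ey]; exists y => //.
    by rewrite !inE yW andbT; apply: contra_not_neq ne => <-.
  by move: yW; rewrite !inE => /andP[].
have T1 t i : 0 < t < 4 -> arr m1 t i = (t == nth 0 w i).
  by move=> t4; rewrite exec_op_arr // exec_op_arr ?ET //= /aAlive; lia.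
have -> : eval N remove_cmd m =
    if test_op N (Less rLim rRem) m1 then exec_op (Put fFail rZ true) m1 else m1 by [].
rewrite (_ : test_op _ _ _ = (l < r.+1)); last first.
  rewrite [LHS](_ : _ = (reg m1 rLim < reg m1 rRem) && (reg m1 rRem < N)) // R1.
  by rewrite lt_rN andbT /= /upd /= EL.
case: ifP => lt_l; split; split; rewrite ?orbF //.
- by rewrite /= /upd /= EZ orbT.
- by move=> t i t4; rewrite exec_op_arr ?T1 //= /fFail; lia.
Qed.

(** The last clause serves to exploit a round without progress: if [W] is unchanged, the visited
    vertex was not removable. *)
Lemma vertex_cmdP k n (H : {set {set 'I_n}}) es m (W : {set 'I_n}) r l f i :
    0 < k -> khypergraph k H -> edge_list H es ->
    let w := enc_hypergraph es in let N := size w in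
    represents w (rX k.-1) m W r l f -> elim_run k H W r l f -> reg m rV = i -> i < N ->
  exists W' r' l' f', [/\ represents w (rX k.-1) (eval N (vertex_cmd k) m) W' r' l' f',
    elim_run k H W' r' l' f', W' \subset W & W' = W -> forall x, val x = i -> x \in W ->
      ~ (dom_in k H W x \/ iso_in k H W x)].
Proof.
move=> k0 kH Hes w N rep run EV lt_iN; have [[EZ EN ER EL] [EF EA ET]] := rep.
have ltnN : n < N by rewrite /N /w /enc_hypergraph size_cat size_rcons size_nseq; lia.
have -> : eval N (vertex_cmd k) m = if i \in vals W then
    eval N (deg_cmd ;; Op (Zero rCnt) ;; nest k.-1 ;;
     If (Same rDeg rCnt) (incs rLim k ;; remove_cmd)
       (If (Same rDeg rZ) remove_cmd Skip)) m else m.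
  by rewrite [LHS]/= EV EA lt_iN andbT.
case: valsP => [[x xW Ei]|nW]; last first.
  by exists W, r, l, f; split=> // _ x Ex xW; case: nW; exists x.
have rX10 : 10 < rX k.-1 by [].
pose m2 := exec_op (Zero rCnt) (eval N deg_cmd m).
pose m3 := eval N (nest k.-1) m2.
have F2 s : s \in [:: rZ; rV; rX k.-1; rRem; rLim; rDeg] -> s != rDeg -> reg m2 s = reg m s.
  rewrite !inE => sI s5; have s11 : (s == rCnt = false) * (s == rP = false) * (s == rCur = false).
    by rewrite /rCnt /rP /rCur; case/or4P: sI => [/eqP->|/eqP->|/eqP->|/or3P[]/eqP->].
  have w2 : ~~ op_writes s (Zero rCnt) by rewrite /= s11.
  have w1 : ~~ writes s deg_cmd by rewrite /= !s11 (negbTE s5).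
  by rewrite (exec_op_reg _ w2) (eval_reg _ _ w1).
have F3 s : s \in [:: rZ; rV; rX k.-1; rRem; rLim; rDeg] -> reg m3 s = reg m2 s.
  rewrite !inE => sI; rewrite eval_reg // writes_nest /rX /rCnt.
  by case/or4P: sI => [/eqP->|/eqP->|/eqP->|/or3P[]/eqP->] //; rewrite /rX; lia.
have A2 b : b != fOk -> b != fHas -> arr m2 b = arr m b.
  by move=> b4 b5; rewrite exec_op_arr // eval_arr //= (negbTE b4) (negbTE b5).
have A3 b : b != fOk -> b != fHas -> arr m3 b = arr m b.
  by move=> b4 b5; rewrite eval_arr ?A2 // puts_nest.
have rep3 : represents w (rX k.-1) m3 W r l f.
  split; split; rewrite ?F3 ?F2 ?A3 ?inE ?eqxx ?orbT //.
  by move=> t j t4; rewrite A3 ?ET // /fOk /fHas; lia.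
have D3 : reg m3 rDeg = scan_deg H W x.
  rewrite F3 // exec_op_reg // (deg_cmdP _ _ EZ ET) //; last by lia.
  by rewrite EV Ei; apply: foldl_scan_enc => // y; rewrite EA mem_vals.
have C3 : reg m3 rCnt = 'C(#|W :\ x|, k.-1).
  rewrite nestP; last by rewrite F2 ?EN // !inE eqxx !orbT.
  rewrite (F2 rV) // (F2 (rX k.-1)) ?EN ?inE ?eqxx ?orbT // add0n -count_vals.
  congr 'C(_, _); apply: eq_count => y; rewrite A2 // EA EV Ei.
  by [].
(* [rCnt] may run off the tape, but the degree does not, so the equality test is exact. *)
have ltD : scan_deg H W x < N by apply: scan_deg_leq.
have lt_r : r.+1 < N.
  by have := elim_run_card run; rewrite (cardsD1 x) xW; lia.
have V3 : reg m3 rV = val x by rewrite F3 // F2 // EV.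
have -> : eval N (deg_cmd ;; Op (Zero rCnt) ;; nest k.-1 ;;
     If (Same rDeg rCnt) (incs rLim k ;; remove_cmd)
       (If (Same rDeg rZ) remove_cmd Skip)) m =
  if scan_deg H W x == 'C(#|W :\ x|, k.-1) then
    eval N remove_cmd (eval N (incs rLim k) m3)
  else if scan_deg H W x == 0 then eval N remove_cmd m3 else m3.
  rewrite [LHS](_ : _ = eval N (If (Same rDeg rCnt) (incs rLim k ;; remove_cmd)
       (If (Same rDeg rZ) remove_cmd Skip)) m3) //.
  have [[Z3 _ _ _] _] := rep3.
  by rewrite [LHS]/= D3 C3 Z3 ltD !andbT.
case: eqP => [/(scan_deg_dom k0 kH xW) dom|ndom].
  exists (W :\ x), r.+1, (l + k), (f || (l + k < r.+1)); split.
  - apply: remove_cmdP => //; last by rewrite reg_incs.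
    have [[Z3 N3 R3 L3] [Fa3 Al3 T3]] := rep3.
    have A4 b : arr (eval N (incs rLim k) m3) b = arr m3 b.
      by rewrite eval_arr // puts_incs.
    split; split; rewrite ?reg_incs ?A4 //= ?L3 //.
    by move=> t j t4; rewrite A4 T3.
  - exact: run_dom.
  - exact: subD1set.
  - by move=> E; move: xW; rewrite -E !inE eqxx.
case: eqP => [/(scan_deg_iso _ _ kH) iso|niso].
  exists (W :\ x), r.+1, l, (f || (l < r.+1)); split.
  - exact: remove_cmdP.
  - exact: run_iso.
  - exact: subD1set.
  - by move=> E; move: xW; rewrite -E !inE eqxx.
exists W, r, l, f; split=> // _ y Ey yW.
have -> : y = x by apply: val_inj; rewrite Ey.
by case=> [/(scan_deg_dom k0 kH xW)|/(scan_deg_iso _ _ kH)].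
Qed.

Lemma enc_tokens n (es : seq {set 'I_n}) :
  all (fun t => 0 < t < 4) (enc_hypergraph es).
Proof.
rewrite /enc_hypergraph all_cat all_rcons all_nseq orbT /=.
elim: es => //= E es IH; rewrite all_cat IH andbT /enc_edge all_cat andbT.
by elim: (enum E) => //= x s IHs; rewrite all_cat IHs andbT all_rcons all_nseq orbT.
Qed.

Lemma vertex_cmd_frame k : 0 < k ->
  [/\ ~~ writes rU (vertex_cmd k), ~~ writes rV (vertex_cmd k) & wf (vertex_cmd k)].
Proof.
by move=> k0; split; rewrite /= ?writes_nest ?writes_incs ?wf_nest ?wf_incs ?andbF.
Qed.

Lemma wf_matching_cmd k : 0 < k -> wf (matching_cmd k).
Proof.
move=> k0; have [wU wV wf_v] := vertex_cmd_frame k0.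
have wf_i : wf (init_cmd k) by rewrite /= wf_incs.
apply/andP; split=> //; apply/andP; split=> //.
by apply/andP; split; [exact: wU | apply/andP].
Qed.

(** By [orderable_good], a round that removes nothing from a nonempty [W] refutes orderability. So
    in the orderable case each round shrinks a nonempty [W], and more than [n] rounds are run. *)
Lemma main_cmdP k n (H : {set {set 'I_n}}) es :
    0 < k -> khypergraph k H -> edge_list H es ->
    let w := enc_hypergraph es in
  exists W r l f, [/\
    represents w (rX k.-1) (eval (size w) (main_cmd k) (init_memory w)) W r l f,
    elim_run k H W r l f & orderable k H -> W = set0].
Proof.
move=> k0 kH Hes w; set N := size w.
have ltnN : n < N by rewrite /N /w /enc_hypergraph size_cat size_rcons size_nseq; lia.
have w1 i : i < n -> nth 0 w i = 1.
  move=> lt_in; rewrite /w /enc_hypergraph nth_cat size_rcons size_nseq ltnS (ltnW lt_in).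
  by rewrite nth_rcons size_nseq lt_in nth_nseq lt_in.
have w3 : nth 0 w n = 3.
  by rewrite /w /enc_hypergraph nth_cat size_rcons size_nseq ltnSn nth_rcons size_nseq ltnn eqxx.
have rep0 := init_cmdP k0 ltnN w1 w3 (enc_tokens es).
have [wU wV _] := vertex_cmd_frame k0.
pose P j m := exists W r l f, [/\ represents w (rX k.-1) m W r l f,
  elim_run k H W r l f & orderable k H -> #|W| <= n - j].
suff [W [r [l [f [rep run cW]]]]] : P N (eval N (main_cmd k) (init_memory w)).
  exists W, r, l, f; split=> // ord; apply/eqP; rewrite -cards_eq0.
  by have := cW ord; lia.
apply: (@eval_ForP N rU (For rV (vertex_cmd k)) P
          (eval N (init_cmd k) (init_memory w))) => //.
  exists setT, 0, 0, (~~ (k %| n)); split.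
  - exact: rep0.
  - exact: run_start.
  - by rewrite cardsT card_ord subn0.
move=> j m0 lt_jN _ [W0 [r0 [l0 [f0 [rep0' run0 c0]]]]].
(* Within a round, either some vertex has been removed or all vertices of [W0] below [i] are known
   to be stuck. *)
pose Q i m := exists W r l f, [/\ represents w (rX k.-1) m W r l f,
  elim_run k H W r l f, W \subset W0 & W = W0 -> forall x, val x < i -> x \in W0 ->
    ~ (dom_in k H W0 x \/ iso_in k H W0 x)].
suff [W [r [l [f [rep run sW stuck]]]]] : Q N (eval N (For rV (vertex_cmd k)) m0).
  exists W, r, l, f; split=> //.
  move=> ord; have c0' := c0 ord; have := subset_leqif_cards sW.
  case: (eqVneq W W0) => [E|ne] [le_c eq_c]; last first.
    have lt_c : #|W| < #|W0| by rewrite ltn_neqAle le_c eq_c.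
    by lia.
  rewrite E; case: (eqVneq W0 set0) => [->|nW0]; first by rewrite cards0.
  have [x xW g] := orderable_good ord nW0.
  by case: (stuck E x _ xW) => //; have := ltn_ord x; rewrite /=; lia.
apply: eval_ForP => //.
  exists W0, r0, l0, f0; split=> //.
move=> i m lt_iN Ei [W [r [l [f [rep run sW stuck]]]]].
have [W' [r' [l' [f' [rep' run' sW' stuck']]]]] := vertex_cmdP k0 kH Hes rep run Ei lt_iN.
exists W', r', l', f'; split=> //.
- exact: subset_trans sW' sW.
move=> E; have EW : W = W0 by apply/eqP; rewrite eqEsubset sW -E.
move=> x; rewrite ltnS leq_eqVlt => /orP[/eqP Ex|lt_x] xW0; last exact: stuck.
by rewrite -EW; apply: stuck'; rewrite ?E ?EW.
Qed.

Theorem theorem1 (k : nat) (hk : 1 <= k) :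
  (exists (M : TM) (c d : nat),
     forall (n : nat) (H : {set {set 'I_n}}) (es : seq {set 'I_n}),
       khypergraph k H -> edge_list H es ->
       decides_within M (enc_hypergraph es) (orderable k H)
         (c * (size (enc_hypergraph es)) ^ d + c))
  /\
  (exists (M : TM) (c d : nat),
     forall (n : nat) (H : {set {set 'I_n}}) (es : seq {set 'I_n}),
       khypergraph k H -> orderable k H -> edge_list H es ->
       decides_within M (enc_hypergraph es) (has_perfect_matching H)
         (c * (size (enc_hypergraph es)) ^ d + c)).
Proof.
have wf2 := wf_matching_cmd hk; have wf1 : wf (main_cmd k) by case/andP: wf2.
have dec_iff M w (p q : Prop) t : (p <-> q) -> decides_within M w p t -> decides_within M w q t.
  by move=> pq [u [le_u [h a]]]; exists u; split=> //; split=> //; rewrite a.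
have ltn_enc n (es : seq {set 'I_n}) : n < size (enc_hypergraph es).
  by rewrite /enc_hypergraph size_cat size_rcons size_nseq; lia.
split.
  (* Accept iff [r = n], that is, iff every vertex has been removed. *)
  have [M [c [d Hdec]]] := cmd_decides (Same rRem (rX k.-1)) wf1.
  exists M, c, d => n H es kH Hes; have ltN := ltn_enc n es.
  apply: dec_iff (Hdec _ (enc_tokens es) _); last by lia.
  have [W [r [l [f [[[_ EN ER _] _] run ordW]]]]] := main_cmdP hk kH Hes.
  have cW := elim_run_card run.
  move: (eval _ _ _) ER EN => m ER EN; rewrite /= ER EN; split=> [/andP[/eqP Er _]|/ordW W0].
    (* A run that reaches the empty set is itself an elimination of all vertices. *)
    apply/eliminable_orderable/(elim_run_eliminable run).
    have -> : W = set0 by apply/eqP; rewrite -cards_eq0; lia.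
    exact: elim_nil.
  by rewrite W0 cards0 in cW; lia.
have [M [c [d Hdec]]] := cmd_decides (Rd fGood rZ) wf2.
exists M, c, d => n H es kH ord Hes; have ltN := ltn_enc n es.
apply: dec_iff (Hdec _ (enc_tokens es) _); last by lia.
have [W [r [l [f [[[EZ _ _ _] [EF _ _]] run ordW]]]]] := main_cmdP hk kH Hes.
rewrite (ordW ord) in run; rewrite (elim_run_set0 hk kH run).
set m := eval _ (main_cmd k) _ in EZ EF.
have G0 : arr m fGood 0 = false.
  rewrite eval_arr; last by rewrite /= puts_nest !puts_incs.
  have := all_nthP 0 (enc_tokens es) 0 (leq_ltn_trans (leq0n n) ltN).
  by rewrite [LHS]/= /fGood; lia.
have -> : eval (size (enc_hypergraph es)) (matching_cmd k)
    (init_memory (enc_hypergraph es)) =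
    if test_op (size (enc_hypergraph es)) (Rd fFail rZ) m then m
    else exec_op (Put fGood rZ true) m by [].
clearbody m.
have -> : test_op (size (enc_hypergraph es)) (Rd fFail rZ) m = f.
  by rewrite /= EZ EF; lia.
case: f {EF run} => /=; first by rewrite EZ G0.
by rewrite /upd /= EZ (leq_ltn_trans (leq0n n) ltN).
Qed.
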